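(* Let $G$ be a finite group, $k$ a field of characteristic $p$ dividing $|G|$, and $H\le G$ a subgroup such that $p$ divides $|H|$. Take the Krull dimension as a dimension function for $kH\text{-stab}$ and $kG\text{-stab}$. Then the stable induction functor $\underline{\operatorname{Ind}}^G_H:kH\text{-stab}\to kG\text{-stab}$ has relative dimension $0$.
   Context: A tensor triangulated category $\mathcal{K}$ is an essentially small triangulated category with a symmetric monoidal structure $(\otimes,\mathbb{I})$ such that $\otimes$ is exact in each variable. A prime ideal of $\mathcal{K}$ is a proper thick triangulated subcategory $\mathcal{P}$ with $\mathcal{K}\otimes\mathcal{P}\subset\mathcal{P}$ such that $A\otimes B\in\mathcal{P}$ implies $A\in\mathcal{P}$ or $B\in\mathcal{P}$. $\operatorname{Spc}(\mathcal{K})$ is the set of prime ideals, topologized by the basis of closed sets $\operatorname{supp}(A)=\{\mathcal{P}: A\notin\mathcal{P}\}$, $A\in\mathcal{K}$. The Krull dimension $\dim_{\mathrm{Krull}}(\mathcal{P})$ of $\mathcal{P}\in\operatorname{Spc}(\mathcal{K})$ is the maximal length $n$ of a chain of non-empty irreducible closed subsets $C_0\subsetneq\dots\subsetneq C_n=\overline{\{\mathcal{P}\}}$; for $V\subset\operatorname{Spc}(\mathcal{K})$, $\dim(V)=\sup_{\mathcal{P}\in V}\dim_{\mathrm{Krull}}(\mathcal{P})$ (so $\dim\emptyset=-\infty$), and for $l\in\mathbb{Z}$, $\mathcal{K}_{(l)}\subset\mathcal{K}$ is the full subcategory of objects $a$ with $\dim(\operatorname{supp}(a))\le l$. An exact functor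 $F:\mathcal{K}\to\mathcal{L}$ (not necessarily a tensor functor) has relative dimension $n\in\mathbb{Z}$ if $F(\mathcal{K}_{(l)})\subset\mathcal{L}_{(l+n)}$ for all $l$ and $n$ is the smallest integer with this property. For a finite group $\Gamma$, $k\Gamma\text{-stab}$ is the stable category of the Frobenius category of finitely generated left $k\Gamma$-modules; it is a tensor triangulated category with tensor product induced by $\otimes_k$ (diagonal action) and unit $k$. $\underline{\operatorname{Ind}}^G_H$ is the exact functor induced on stable categories by $\operatorname{Ind}^G_H=kG\otimes_{kH}-$, which is exact and preserves projectives. *)

(* Defs.v *)
From HB Require Import structures.
From mathcomp Require Import all_boot all_order all_algebra all_fingroup.
From mathcomp Require Import mxrepresentation character mxtens.
From mathcomp Require Import boolp classical_sets constructive_ereal topology.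

Set Implicit Arguments.
Unset Strict Implicit.
Unset Printing Implicit Defensive.

Import GRing.Theory Num.Theory.
Local Open Scope ring_scope.
Local Open Scope classical_set_scope.

(* The data of a tensor triangulated category, with hom-sets presented as     *)
(* setoids.  Prime ideals, Spc, Krull dimension and exact functors only       *)
(* depend on these data, so the axioms of a tensor triangulated category are  *)
(* not recorded: the only instances used below are stable module categories.  *)
Record tt_data := TTData {
  tt_obj :> Type;
  tt_hom : tt_obj -> tt_obj -> Type;
  tt_eq : forall X Y, tt_hom X Y -> tt_hom X Y -> Prop;
  tt_id : forall X, tt_hom X X;
  tt_comp : forall X Y Z, tt_hom Y Z -> tt_hom X Y -> tt_hom X Z;
  tt_add : forall X Y, tt_hom X Y -> tt_hom X Y -> tt_hom X Y;
  tt_shift : tt_obj -> tt_obj;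
  tt_shift_hom : forall X Y, tt_hom X Y -> tt_hom (tt_shift X) (tt_shift Y);
  tt_triangle : forall X Y Z,
    tt_hom X Y -> tt_hom Y Z -> tt_hom Z (tt_shift X) -> Prop;
  tt_tensor : tt_obj -> tt_obj -> tt_obj;
  tt_unit : tt_obj
}.

Declare Scope tt_scope.
Delimit Scope tt_scope with tt.
Local Open Scope tt_scope.
Notation "f ≈ g" := (tt_eq f g) (at level 70) : tt_scope.
Notation "g ∘ f" := (tt_comp g f) (at level 40, left associativity) : tt_scope.

Section Spectrum.
Variable K : tt_data.
Implicit Types (P : set K) (X Y Z : K).

Definition tt_iso X Y (f : tt_hom X Y) :=
  exists2 g : tt_hom Y X, g ∘ f ≈ tt_id X & f ∘ g ≈ tt_id Y.

Definition retract X Y :=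
  exists (i : tt_hom X Y) (r : tt_hom Y X), r ∘ i ≈ tt_id X.

(* A full subcategory is given by its set of objects.  Closure under          *)
(* isomorphism is the case of retracts that are isomorphisms, and the zero    *)
(* object is the cone of an identity.                                         *)
Record thick_triangulated P : Prop := {
  thick_nonempty : P !=set0;
  thick_shift : forall X, P (tt_shift X) <-> P X;
  thick_triangle : forall X Y Z (f : tt_hom X Y) (g : tt_hom Y Z)
      (h : tt_hom Z (tt_shift X)), tt_triangle f g h ->
    [/\ P X -> P Y -> P Z, P Y -> P Z -> P X & P X -> P Z -> P Y];
  thick_retract : forall X Y, retract X Y -> P Y -> P X
}.

Record prime_ideal P : Prop := {
  prime_thick : thick_triangulated P;
  prime_proper : P != setT;
  prime_tensor : forall X Y, P Y -> P (tt_tensor X Y);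
  prime_prime : forall X Y, P (tt_tensor X Y) -> P X \/ P Y
}.

End Spectrum.

Record Spc (K : tt_data) := PrimeIdeal {
  prime_set :> set K;
  prime_setP : prime_ideal prime_set
}.

HB.instance Definition _ (K : tt_data) := gen_eqMixin (Spc K).
HB.instance Definition _ (K : tt_data) := gen_choiceMixin (Spc K).

Definition supp (K : tt_data) (A : K) : set (Spc K) := [set P | ~ prime_set P A].

(* Since supp(A) `|` supp(B) = supp(A (+) B), the complements of the supports *)
(* form not only a subbase but a base of the topology they generate.          *)
HB.instance Definition _ (K : tt_data) :=
  @isSubBaseTopological.Build (Spc K) (set (Spc K))
    (range (fun A : K => ~` supp A)) id.

Section Dimension.
Variable T : topologicalType.
Implicit Types (C : set T) (x : T).

Definition irreducible_closed C :=
  [/\ closed C, C !=set0 &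
      forall A B, closed A -> closed B -> C `<=` A `|` B ->
        C `<=` A \/ C `<=` B].

Definition closed_chain x (n : nat) := exists C : nat -> set T,
  [/\ forall i, (i <= n)%N -> irreducible_closed (C i),
      forall i, (i < n)%N -> C i `<` C i.+1 &
      C n = closure [set x]].

(* Every subset of \bar int has a least upper bound; the first argument of    *)
(* [supremum] is the value at the empty set.                                  *)
Definition krull_dim x : \bar int :=
  supremum -oo%E [set n%:Z%:E | n in closed_chain x].

Definition set_dim (V : set T) : \bar int :=
  supremum -oo%E [set krull_dim x | x in V].

End Dimension.

(* The full subcategory K_(l), given by its set of objects. *)
Definition dim_le (K : tt_data) (l : int) : set K :=
  [set A | (set_dim (supp A) <= l%:E)%E].

Record tt_functor (K L : tt_data) := TTFunctor {
  fun_obj :> K -> L;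
  fun_hom : forall X Y, tt_hom X Y -> tt_hom (fun_obj X) (fun_obj Y)
}.

Record exact_functor (K L : tt_data) (F : tt_functor K L) : Prop := {
  exact_eq : forall X Y (f g : tt_hom X Y), f ≈ g -> fun_hom F f ≈ fun_hom F g;
  exact_id : forall X, fun_hom F (tt_id X) ≈ tt_id (F X);
  exact_comp : forall X Y Z (g : tt_hom Y Z) (f : tt_hom X Y),
    fun_hom F (g ∘ f) ≈ fun_hom F g ∘ fun_hom F f;
  exact_add : forall X Y (f g : tt_hom X Y),
    fun_hom F (tt_add f g) ≈ tt_add (fun_hom F f) (fun_hom F g);
  exact_triangle :
    exists phi : forall X, tt_hom (F (tt_shift X)) (tt_shift (F X)),
    [/\ forall X, tt_iso (phi X),
        forall X Y (f : tt_hom X Y),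
          tt_shift_hom (fun_hom F f) ∘ phi X ≈
          phi Y ∘ fun_hom F (tt_shift_hom f) &
        forall X Y Z (f : tt_hom X Y) (g : tt_hom Y Z)
            (h : tt_hom Z (tt_shift X)), tt_triangle f g h ->
          tt_triangle (fun_hom F f) (fun_hom F g) (phi X ∘ fun_hom F h)]
}.

Definition relative_dim_le (K L : tt_data) (F : tt_functor K L) (n : int) :=
  forall l A, dim_le l A -> dim_le (l + n) (F A).

Definition has_relative_dimension (K L : tt_data) (F : tt_functor K L)
    (n : int) :=
  [/\ exact_functor F, relative_dim_le F n &
      forall m, relative_dim_le F m -> n <= m].

(* A finitely generated kG-module is a matrix representation M : G acts on    *)
(* the row space 'rV_(rdegree M) from the right, or from the left by          *)
(* g . v = v *m M g^-1.  Passing from left to right modules in this way       *)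
(* respects diagonal tensor products and turns kG (x)_kH M, with left action  *)
(* of G, into M (x)_kH kG, via g (x) v |-> v (x) g^-1.                        *)
Section Modules.
Variables (k : fieldType) (gT : finGroupType) (G : {group gT}).
Local Notation module := (representation k G).
Implicit Types M N X Y : module.

Record mod_hom M N := ModHom {
  mx_of_hom :> 'M[k]_(rdegree M, rdegree N);
  mx_of_homP : forall x, x \in G -> M x *m mx_of_hom = mx_of_hom *m N x
}.

Lemma id_hom_subproof M x :
  x \in G -> M x *m 1%:M = 1%:M *m M x.
Proof. by rewrite mulmx1 mul1mx. Qed.
Definition id_hom M := @ModHom M M 1%:M (@id_hom_subproof M).

Lemma comp_hom_subproof M N X (g : mod_hom N X) (f : mod_hom M N) x :
  x \in G ->
  M x *m (mx_of_hom f *m mx_of_hom g) = (mx_of_hom f *m mx_of_hom g) *m X x.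
Proof. by move=> Gx; rewrite mulmxA mx_of_homP // -!mulmxA mx_of_homP. Qed.
Definition comp_hom M N X (g : mod_hom N X) (f : mod_hom M N) :=
  @ModHom M X (f *m g) (comp_hom_subproof g f).

Lemma add_hom_subproof M N (f g : mod_hom M N) x :
  x \in G ->
  M x *m (mx_of_hom f + mx_of_hom g) = (mx_of_hom f + mx_of_hom g) *m N x.
Proof. by move=> Gx; rewrite mulmxDr mulmxDl !mx_of_homP. Qed.
Definition add_hom M N (f g : mod_hom M N) :=
  ModHom (add_hom_subproof f g).

(* As a linear map on row vectors, g is surjective iff [row_full g]. *)
Definition projective P := forall M N (g : mod_hom M N) (f : mod_hom P N),
  row_full g -> exists h : mod_hom P M, h *m g = f.

Definition stable_eq M N (f g : mod_hom M N) :=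
  exists P (a : mod_hom M P) (b : mod_hom P N),
    projective P /\ mx_of_hom f - mx_of_hom g = a *m b.

Lemma tens_mx_repr M N : mx_repr G (fun x => M x *t N x).
Proof.
split=> [|x y Gx Gy]; last by rewrite tensmx_mul !repr_mxM.
rewrite !repr_mx1; apply/matrixP=> i j.
case: (mxtens_indexP i) => i1 i2; case: (mxtens_indexP j) => j1 j2.
rewrite tensmxE !mxE (inj_eq (can_inj (@mxtens_indexK _ _))) xpair_eqE.
by rewrite -mulnb natrM.
Qed.
Definition tens_module M N : module :=
  Representation (MxRepresentation (tens_mx_repr M N)).

Lemma triv_mx_repr : mx_repr G (fun=> 1%:M : 'M[k]_1).
Proof. by split=> // x y _ _; rewrite mulmx1. Qed.
Definition triv_module : module :=
  Representation (MxRepresentation triv_mx_repr).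

Definition quot_module M (U : 'M_(rdegree M)) (modU : mxmodule M U) :
  module := Representation (factmod_repr modU).

Lemma quot_proj_subproof M (U : 'M_(rdegree M)) (modU : mxmodule M U) x :
  x \in G ->
  M x *m in_factmod U 1%:M = in_factmod U 1%:M *m quot_module modU x.
Proof. by move=> Gx; rewrite /= -in_factmodJ // mul1mx -in_factmodE. Qed.
Definition quot_proj M (U : 'M_(rdegree M)) (modU : mxmodule M U) :=
  @ModHom M (quot_module modU) (in_factmod U 1%:M) (quot_proj_subproof modU).

Lemma quot_hom_subproof M N (U : 'M_(rdegree M)) (V : 'M_(rdegree N))
    (modU : mxmodule M U) (modV : mxmodule N V)
    (f : mod_hom M N) (sUV : (U *m f <= V)%MS) x : x \in G ->
  quot_module modU x *m (val_factmod (U := U) 1%:M *m f *m in_factmod V 1%:M) =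
  (val_factmod (U := U) 1%:M *m f *m in_factmod V 1%:M) *m quot_module modV x.
Proof.
move=> Gx; set v := val_factmod 1%:M.
have val_in : (in_factmod U (v *m M x) *m v) *m f *m in_factmod V 1%:M
    = (v *m M x) *m f *m in_factmod V 1%:M.
  apply/eqP; rewrite -subr_eq0 -!mulmxBl -in_factmodE in_factmod_eq0.
  apply: submx_trans sUV; apply: submxMr; rewrite -val_factmodE.
  rewrite -[X in _ - X](add_sub_fact_mod U) opprD addrCA subrr addr0.
  by rewrite eqmx_opp val_submodP.
transitivity (in_factmod U (v *m M x) *m v *m f *m in_factmod V 1%:M).
  by rewrite -!mulmxA.
rewrite val_in -(mulmxA v) mx_of_homP // -!mulmxA.
by rewrite (quot_proj_subproof modV Gx) -!mulmxA.
Qed.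
Definition quot_hom M N (U : 'M_(rdegree M)) (V : 'M_(rdegree N))
    (modU : mxmodule M U) (modV : mxmodule N V) (f : mod_hom M N)
    (sUV : (U *m f <= V)%MS) :=
  @ModHom (quot_module modU) (quot_module modV)
    (val_factmod (U := U) 1%:M *m f *m in_factmod V 1%:M)
    (quot_hom_subproof modU modV sUV).


(* The embedding eta : X -> I(X) := X (x) kG, v |-> v (x) \sum_g g, of X into *)
(* a free, hence injective, module; its cokernel is the shift of X.           *)
Definition inj_hull X :=
  tens_module X (Representation (regular_repr k G)).

Definition hull_emb_mx X : 'M[k]_(rdegree X, rdegree (inj_hull X)) :=
  \matrix_(i, j) (i == (mxtens_unindex j).1)%:R.

Lemma hull_emb_subproof X x :
  x \in G -> X x *m hull_emb_mx X = hull_emb_mx X *m inj_hull X x.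
Proof.
move=> Gx; apply/matrixP=> i j; case: (mxtens_indexP j) => j1 j2.
rewrite !mxE (bigD1 j1) //= !mxE mxtens_indexK eqxx mulr1 big1 ?addr0; last first.
  by move=> l /negPf nl; rewrite !mxE mxtens_indexK nl mulr0.
pose l2 := gring_index G (enum_val j2 * x^-1)%g.
have l2x : gring_index G (enum_val l2 * x)%g = j2.
  by rewrite gring_indexK ?mulgKV ?gring_valK // groupM ?groupV ?enum_valP.
rewrite (bigD1 (mxtens_index (i, l2))) //= !mxE !mxtens_indexK !eqxx /= mul1r.
rewrite l2x eqxx mulr1 big1 ?addr0 // => l; case: (mxtens_indexP l) => l1 l3.
rewrite !mxE !mxtens_indexK /= (inj_eq (can_inj (@mxtens_indexK _ _))).
rewrite xpair_eqE eq_sym; case: (i == l1) => /=; rewrite ?mul0r // mul1r => nl.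
rewrite (_ : j2 == _ = false) ?mulr0 //; apply: contraNF nl => /eqP E.
by rewrite /l2 E gring_indexK ?mulgK ?gring_valK // groupM ?enum_valP.
Qed.
Definition hull_emb X := ModHom (@hull_emb_subproof X).

Lemma hull_emb_mod X : mxmodule (inj_hull X) <<hull_emb X>>%MS.
Proof.
rewrite (eqmx_module _ (genmxE _)); apply/mxmoduleP=> x Gx.
by rewrite -(mx_of_homP (hull_emb X) Gx) submxMl.
Qed.

Definition shift X := quot_module (hull_emb_mod X).
Definition shift_proj X : mod_hom (inj_hull X) (shift X) :=
  quot_proj (hull_emb_mod X).

Lemma hull_hom_subproof X Y (f : mod_hom X Y) x : x \in G ->
  inj_hull X x *m (mx_of_hom f *t 1%:M) = (mx_of_hom f *t 1%:M) *m inj_hull Y x.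
Proof. by move=> Gx; rewrite !tensmx_mul mx_of_homP // mul1mx mulmx1. Qed.
Definition hull_hom X Y (f : mod_hom X Y) :=
  @ModHom (inj_hull X) (inj_hull Y) (mx_of_hom f *t 1%:M) (hull_hom_subproof f).

Lemma shift_hom_subproof X Y (f : mod_hom X Y) :
  (<<hull_emb X>> *m hull_hom f <= <<hull_emb Y>>)%MS.
Proof.
rewrite genmxE (eqmxMr _ (genmxE _)).
suff -> : hull_emb X *m hull_hom f = f *m hull_emb Y by rewrite submxMl.
apply/matrixP=> i j; case: (mxtens_indexP j) => j1 j2.
rewrite !mxE (bigD1 (mxtens_index (i, j2))) //= !mxE !mxtens_indexK /= !eqxx.
rewrite mul1r mulr1 (bigD1 j1) //= !mxE mxtens_indexK eqxx mulr1.
rewrite !big1 // => l.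
  by move/negPf=> nl; rewrite !mxE mxtens_indexK nl mulr0.
case: (mxtens_indexP l) => l1 l2; rewrite !mxE !mxtens_indexK /=.
rewrite (inj_eq (can_inj (@mxtens_indexK _ _))) xpair_eqE eq_sym.
by case: (i == l1); rewrite ?mul0r //= => /negPf nl; rewrite nl !mulr0.
Qed.
Definition shift_hom X Y (f : mod_hom X Y) : mod_hom (shift X) (shift Y) :=
  quot_hom (hull_emb_mod X) (hull_emb_mod Y) (shift_hom_subproof f).

Definition is_pushout A B C D (f : mod_hom A B) (g : mod_hom A C)
    (f' : mod_hom C D) (g' : mod_hom B D) :=
  f *m g' = g *m f' /\
  forall E (b : mod_hom B E) (c : mod_hom C E), f *m b = g *m c ->
    exists2 d : mod_hom D E, g' *m d = b /\ f' *m d = c &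
      forall d' : mod_hom D E, g' *m d' = b -> f' *m d' = c ->
        mx_of_hom d' = d.

(* X --u--> Y --v--> Z --w--> shift X, with Z the pushout of eta and u. *)
Definition standard_triangle X Y Z (u : mod_hom X Y) (v : mod_hom Y Z)
    (w : mod_hom Z (shift X)) :=
  exists c : mod_hom (inj_hull X) Z,
    [/\ is_pushout (hull_emb X) u v c, v *m w = 0 & c *m w = shift_proj X].

Definition stable_iso X Y (f : mod_hom X Y) :=
  exists2 g : mod_hom Y X,
    stable_eq (comp_hom g f) (id_hom X) & stable_eq (comp_hom f g) (id_hom Y).

Definition stable_triangle X Y Z (u : mod_hom X Y) (v : mod_hom Y Z)
    (w : mod_hom Z (shift X)) :=
  exists X' Y' Z' (u' : mod_hom X' Y') (v' : mod_hom Y' Z')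
      (w' : mod_hom Z' (shift X'))
      (a : mod_hom X X') (b : mod_hom Y Y') (c : mod_hom Z Z'),
    [/\ standard_triangle u' v' w',
        [/\ stable_iso a, stable_iso b & stable_iso c] &
        [/\ stable_eq (comp_hom b u) (comp_hom u' a),
            stable_eq (comp_hom c v) (comp_hom v' b) &
            stable_eq (comp_hom (shift_hom a) w) (comp_hom w' c)]].

Definition stable_category : tt_data :=
  {| tt_obj := module;
     tt_hom := mod_hom;
     tt_eq := stable_eq;
     tt_id := id_hom;
     tt_comp := comp_hom;
     tt_add := add_hom;
     tt_shift := shift;
     tt_shift_hom := shift_hom;
     tt_triangle := stable_triangle;
     tt_tensor := tens_module;
     tt_unit := triv_module |}.

End Modules.

Section Induction.
Variables (k : fieldType) (gT : finGroupType) (G H : {group gT}).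
Hypothesis sHG : H \subset G.
Local Notation kG := (Representation (regular_repr k G)).
Implicit Types M N : representation k H.

(* M (x)_k kG, on which G acts through the second factor only. *)
Lemma free_mx_repr M : mx_repr G (fun x => (1%:M : 'M_(rdegree M)) *t kG x).
Proof.
have M1 n p : (1%:M : 'M[k]_n) *t (1%:M : 'M[k]_p) = 1%:M.
  apply/matrixP=> i j.
  case: (mxtens_indexP i) => i1 i2; case: (mxtens_indexP j) => j1 j2.
  rewrite tensmxE !mxE (inj_eq (can_inj (@mxtens_indexK _ _))) xpair_eqE.
  by rewrite -mulnb natrM.
by split=> [|x y Gx Gy]; rewrite ?repr_mx1 // tensmx_mul mul1mx repr_mxM.
Qed.
Definition free_module M : representation k G :=
  Representation (MxRepresentation (free_mx_repr M)).

(* Left multiplication by h on kG. *)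
Definition lreg_mx h : 'M[k]_#|G| :=
  \matrix_i delta_mx 0 (gring_index G (h * enum_val i)%g).

Lemma lreg_mxC h x : h \in G -> x \in G ->
  lreg_mx h *m kG x = kG x *m lreg_mx h.
Proof.
move=> Gh Gx; apply/row_matrixP=> i; rewrite !row_mul !rowK -!rowE !rowK.
by rewrite !gring_indexK ?groupM ?enum_valP // mulgA.
Qed.

(* The span of all v h (x) g - v (x) h g: the kernel of the projection        *)
(* M (x)_k kG -> M (x)_kH kG.                                                 *)
Definition balanced_rel M : 'M[k]_(rdegree (free_module M)) :=
  (\sum_(h in H) (M h *t 1%:M - 1%:M *t lreg_mx h)%R)%MS.

Lemma balanced_rel_mod M : mxmodule (free_module M) (balanced_rel M).
Proof.
apply/mxmoduleP=> x Gx; rewrite /balanced_rel sumsmxMr; apply/sumsmx_subP=> h Hh.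
apply: submx_trans (sumsmx_sup h Hh (submx_refl _)).
have -> : (M h *t 1%:M - 1%:M *t lreg_mx h) *m free_module M x
    = free_module M x *m (M h *t 1%:M - 1%:M *t lreg_mx h).
  rewrite mulmxBl mulmxBr !tensmx_mul !(mul1mx, mulmx1).
  by rewrite lreg_mxC // (fintype.subsetP sHG).
exact: submxMl.
Qed.

Definition ind M := quot_module (balanced_rel_mod M).

Lemma free_hom_subproof M N (f : mod_hom M N) x : x \in G ->
  free_module M x *m (mx_of_hom f *t 1%:M)
    = (mx_of_hom f *t 1%:M) *m free_module N x.
Proof. by move=> Gx; rewrite !tensmx_mul !(mul1mx, mulmx1). Qed.
Definition free_hom M N (f : mod_hom M N) :=
  @ModHom k gT G (free_module M) (free_module N) (mx_of_hom f *t 1%:M)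
    (free_hom_subproof f).

Lemma ind_hom_subproof M N (f : mod_hom M N) :
  (balanced_rel M *m free_hom f <= balanced_rel N)%MS.
Proof.
rewrite /balanced_rel sumsmxMr_gen; apply/sumsmx_subP=> h Hh.
rewrite genmxE.
apply: submx_trans (sumsmx_sup h Hh (submx_refl _)).
have -> : (M h *t 1%:M - 1%:M *t lreg_mx h) *m free_hom f
    = free_hom f *m (N h *t 1%:M - 1%:M *t lreg_mx h).
  by rewrite mulmxBl mulmxBr !tensmx_mul !(mul1mx, mulmx1) mx_of_homP.
exact: submxMl.
Qed.
Definition ind_hom M N (f : mod_hom M N) : mod_hom (ind M) (ind N) :=
  quot_hom (balanced_rel_mod M) (balanced_rel_mod N) (ind_hom_subproof f).

Definition stable_ind :
    tt_functor (stable_category k H) (stable_category k G) :=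
  @TTFunctor (stable_category k H) (stable_category k G) ind ind_hom.

End Induction.

(* Main.v *)
Require Import Defs.
From mathcomp Require Import all_boot all_order all_algebra all_fingroup.
From mathcomp Require Import mxrepresentation character mxtens.
From mathcomp Require Import pgroup cyclic finfield finmap ring zify.
From mathcomp Require Import boolp classical_sets constructive_ereal topology.

(** Write Ind and Res for induction and restriction between the stable
categories of [H] and [G].  Three things are to be shown.

Induction is an exact functor ([stable_ind_exact]).  Induced modules are
characterized by a system of imprimitivity ([induced_data]): they are direct sums
of translates of [M] over the cosets of [H].  From this, induction preserves
short exact sequences and projective modules.  A standard triangle on
[u : X -> Y] is the pushout of the embedding of [X] into its injective hull along
[u].  Induction sends it to a pushout along another embedding into an injective
module, and the two are compared by extending maps to injective modules
([mid_compare_iso]).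

Induction does not raise the dimension of supports ([stable_ind_dim_le]).
Restriction is an exact tensor functor, so it induces a map [spc_res] of spectra.
Given a prime [P] of [G], the objects [X] such that Ind (X ⊗ Y) lies in [P] for
all [Y] form an ideal [ind_ideal P].  By Frobenius reciprocity it contains Res
[P], and a product of [Y] with the restriction of an object outside [P] belongs
to it only if [Y] does.  Hence any set of objects that contains the unit, is
closed under tensor products and avoids this ideal is avoided by some prime of
[H] over [P] ([prime_lift], by Zorn's lemma).  Two choices of the set give that
the support of Ind [A] is contained in the image of the support of [A]
([supp_ind]), and that specializations lift along [spc_res] ([spc_res_up]).
Irreducible closed sets of the spectrum have generic points ([spc_sober]), so
chains of irreducible closed sets lift as well ([going_up_chain]), and the
dimension of [P] is at most that of any prime over it.

The bound 0 is optimal.  By Cauchy's theorem [H] has a subgroup [C] of order [p].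
A non-projective module over [C] has an equivariant endomorphism of nonzero trace
([trace_zero_traceable]), so the trivial module is a summand of its endomorphism
module; therefore the projective modules form the only prime ideal of [C].  It
follows that the module [A] induced from the trivial module of [C] to [H] has
support of dimension 0.  As [A] is a summand of Res Ind [A], the support of Ind
[A] is not empty, so its dimension is not negative, and induction from [H] to [G]
cannot lower dimensions by a fixed positive amount. *)

Set Implicit Arguments.
Unset Strict Implicit.
Unset Printing Implicit Defensive.

Import Order.TTheory GRing.Theory Num.Theory.
Local Open Scope ring_scope.
Local Open Scope classical_set_scope.


(** * Exactness and the transfer *)

Definition split_exact (k : fieldType) a b c (f : 'M[k]_(a, b)) (g : 'M_(b, c)) :=
  exists (s : 'M_(b, a)) (t : 'M_(c, b)),
    [/\ f *m s = 1%:M, t *m g = 1%:M, f *m g = 0 & s *m f + g *m t = 1%:M].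

Section Transfer.
Variables (k : fieldType) (gT : finGroupType) (G : {group gT}).
Local Notation module := (representation k G).
Implicit Types L M N X Y Z I : module.

Lemma repr_mulVK M x m (A : 'M_(rdegree M, m)) :
  x \in G -> M x^-1%g *m (M x *m A) = A.
Proof.
by move=> Gx; rewrite mulmxA -repr_mxM ?groupV // mulVg repr_mx1 mul1mx.
Qed.

Definition equivariant M N (f : 'M_(rdegree M, rdegree N)) :=
  forall x, x \in G -> M x *m f = f *m N x.
Arguments equivariant : clear implicits.

(** The relative trace from the trivial subgroup, averaging a linear map over
[G].  Its values are the maps that vanish stably (see [stable_eqP]). *)
Definition transfer M N (s : 'M_(rdegree M, rdegree N)) :=
  \sum_(x in G) M x^-1%g *m s *m N x.
Arguments transfer : clear implicits.

Lemma equiv1 M : equivariant M M 1%:M.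
Proof. by move=> x _; rewrite mulmx1 mul1mx. Qed.

Lemma equiv0 M N : equivariant M N 0.
Proof. by move=> x _; rewrite mulmx0 mul0mx. Qed.

Lemma equivB M N f g : equivariant M N f -> equivariant M N g -> equivariant M N (f - g).
Proof. by move=> ef eg x Gx; rewrite mulmxBl mulmxBr ef ?eg. Qed.

Lemma transfer_equiv M N s : equivariant M N (transfer M N s).
Proof.
move=> x Gx; rewrite mulmx_sumr mulmx_suml.
rewrite (reindex_inj (mulIg x)); apply: eq_big => [y|y Gy].
  by rewrite groupMr.
rewrite invMg !mulmxA -repr_mxM ?groupM ?groupV //; last first.
  by move: Gy; rewrite groupMr.
have Gy' : y \in G by move: Gy; rewrite groupMr.
by rewrite mulKVg -!mulmxA -repr_mxM ?groupV.
Qed.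

Lemma transferMl L M N (f : 'M_(rdegree L, rdegree M)) s : equivariant L M f ->
  f *m transfer M N s = transfer L N (f *m s).
Proof.
move=> ef; rewrite mulmx_sumr; apply: eq_bigr => x Gx.
by rewrite !mulmxA ef ?groupV.
Qed.

Lemma transferMr L M N (f : 'M_(rdegree M, rdegree N)) s : equivariant M N f ->
  transfer L M s *m f = transfer L N (s *m f).
Proof.
move=> ef; rewrite mulmx_suml; apply: eq_bigr => x Gx.
by rewrite -!mulmxA ef.
Qed.

Lemma transferB M N r s :
  transfer M N (r - s) = transfer M N r - transfer M N s.
Proof.
by rewrite -sumrB; apply: eq_bigr => x _; rewrite mulmxBr mulmxBl.
Qed.

Lemma transferD M N r s :
  transfer M N (r + s) = transfer M N r + transfer M N s.
Proof.
by rewrite -big_split; apply: eq_bigr => x _; rewrite mulmxDr mulmxDl.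
Qed.

Lemma transfer0 M N : transfer M N 0 = 0.
Proof. by rewrite -[X in transfer _ _ X](subrr 0) transferB subrr. Qed.

Lemma transferN M N s : transfer M N (- s) = - transfer M N s.
Proof. by rewrite -sub0r transferB transfer0 sub0r. Qed.

(** Higman's criterion for projectivity (see [projectiveP]).  It replaces a
quantification over all lifting problems by one equation, which is stable under
tensor products, duality, restriction and induction. *)
Definition traceable M := exists s, transfer M M s = 1%:M.

Definition stably_eq M N (f g : 'M_(rdegree M, rdegree N)) :=
  exists s, f - g = transfer M N s.
Arguments stably_eq : clear implicits.

Lemma stably_refl M N f : stably_eq M N f f.
Proof. by exists 0; rewrite subrr transfer0. Qed.

Lemma stably_sym M N f g : stably_eq M N f g -> stably_eq M N g f.
Proof. by case=> s fg; exists (- s); rewrite transferN -fg opprB. Qed.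

Lemma stably_trans M N f g h :
  stably_eq M N f g -> stably_eq M N g h -> stably_eq M N f h.
Proof.
move=> [s fg] [r gh]; exists (s - - r).
by rewrite transferB transferN -fg -gh opprK addrA subrK.
Qed.

Lemma stably_mul_l L M N (a : 'M_(rdegree L, rdegree M)) f g : equivariant L M a ->
  stably_eq M N f g -> stably_eq L N (a *m f) (a *m g).
Proof. by move=> ea [s fg]; exists (a *m s); rewrite -mulmxBr fg transferMl. Qed.

Lemma stably_mul_r L M N (a : 'M_(rdegree M, rdegree N)) f g : equivariant M N a ->
  stably_eq L M f g -> stably_eq L N (f *m a) (g *m a).
Proof. by move=> ea [s fg]; exists (s *m a); rewrite -mulmxBl fg transferMr. Qed.

(** Inserting [transfer I I s = 1] between [a] and [b] exhibits [a *m b] as a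
transfer. *)
Lemma factor_stably_eq M N I (a : 'M_(rdegree M, rdegree I))
    (b : 'M_(rdegree I, rdegree N)) f g : traceable I ->
  equivariant M I a -> equivariant I N b -> f - g = a *m b -> stably_eq M N f g.
Proof.
move=> [s s1] ea eb eab; exists (a *m s *m b); rewrite eab.
by rewrite -transferMr // -transferMl // s1 mulmx1.
Qed.

(** A linear extension of [g] exists since [f] splits linearly; its composite
with [s] is made equivariant by averaging, and restricts to [g] because
[transfer I I s = 1].  The next lemma is dual. *)
Lemma traceable_injective M N I (f : 'M_(rdegree M, rdegree N))
    (g : 'M_(rdegree M, rdegree I)) r : traceable I ->
  equivariant M N f -> equivariant M I g -> f *m r = 1%:M ->
  exists2 h, equivariant N I h & f *m h = g.
Proof.
move=> [s s1] ef eg fr; exists (transfer N I (r *m g *m s)).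
  exact: transfer_equiv.
by rewrite transferMl // !mulmxA fr mul1mx -transferMl // s1 mulmx1.
Qed.

Lemma traceable_projective M N I (f : 'M_(rdegree I, rdegree N))
    (g : 'M_(rdegree M, rdegree N)) r : traceable I ->
  equivariant M N g -> equivariant I N f -> r *m g = 1%:M ->
  exists2 h, equivariant I M h & h *m g = f.
Proof.
move=> [s s1] eg ef rg; exists (transfer I M (s *m f *m r)).
  exact: transfer_equiv.
by rewrite transferMr // -!mulmxA rg mulmx1 -transferMr // s1 mul1mx.
Qed.

Lemma traceable_retract M N (i : 'M_(rdegree M, rdegree N)) r :
  equivariant M N i -> equivariant N M r -> i *m r = 1%:M -> traceable N -> traceable M.
Proof.
move=> ei er ir [s s1]; exists (i *m s *m r).
by rewrite -transferMr // -transferMl // s1 mulmx1.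
Qed.

Lemma tens1mx1 m n : (1%:M : 'M[k]_m) *t (1%:M : 'M[k]_n) = 1%:M.
Proof.
apply/matrixP=> i j.
case: (mxtens_indexP i) => i1 i2; case: (mxtens_indexP j) => j1 j2.
rewrite tensmxE !mxE (inj_eq (can_inj (@mxtens_indexK _ _))) xpair_eqE.
by rewrite -mulnb natrM.
Qed.

Lemma tensmx_sumr (I : finType) (P : pred I) m n p q (A : 'M[k]_(m, n))
    (F : I -> 'M[k]_(p, q)) :
  A *t (\sum_(i | P i) F i) = \sum_(i | P i) A *t F i.
Proof.
apply/matrixP=> i j; rewrite summxE mxE summxE mulr_sumr.
by apply: eq_bigr => x _; rewrite mxE.
Qed.

Lemma tensmx_suml (I : finType) (P : pred I) m n p q (A : 'M[k]_(m, n))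
    (F : I -> 'M[k]_(p, q)) :
  (\sum_(i | P i) F i) *t A = \sum_(i | P i) F i *t A.
Proof.
apply/matrixP=> i j; rewrite summxE mxE summxE mulr_suml.
by apply: eq_bigr => x _; rewrite mxE.
Qed.

Lemma tensmxDl m n p q (A : 'M[k]_(m, n)) B (C : 'M[k]_(p, q)) :
  (A + B) *t C = A *t C + B *t C.
Proof. by apply/matrixP=> i j; rewrite !mxE mulrDl. Qed.

Lemma traceable_tensl M N : traceable M -> traceable (tens_module M N).
Proof.
move=> [s s1]; exists (s *t 1%:M); rewrite -tens1mx1 -s1 tensmx_suml.
apply: eq_bigr => x Gx; rewrite !tensmx_mul mulmx1 -repr_mxM ?groupV //.
by rewrite mulVg repr_mx1.
Qed.

Lemma traceable_tensr M N : traceable N -> traceable (tens_module M N).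
Proof.
move=> [s s1]; exists (1%:M *t s); rewrite -tens1mx1 -s1 tensmx_sumr.
apply: eq_bigr => x Gx; rewrite !tensmx_mul mulmx1 -repr_mxM ?groupV //.
by rewrite mulVg repr_mx1.
Qed.

(** The conjugates of the projection onto the line of the neutral element are
the projections onto the lines of the group elements, and these add up to 1. *)
Lemma traceable_regular : traceable (Representation (regular_repr k G)).
Proof.
pose e := gring_index G 1; exists (delta_mx e e).
rewrite mx1_sum_delta /transfer big_enum_val; apply: eq_bigr => a _.
have Ga : enum_val a \in G := enum_valP a.
rewrite -(mul_delta_mx (0 : 'I_1)) mulmxA -mulmxA -rowE rowK.
rewrite gring_indexK // mul1g gring_valK -(mul_delta_mx (0 : 'I_1) a a).
congr (_ *m _); rewrite -colE; apply/matrixP=> i j.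
rewrite !mxE !ord1 eqxx andbT /=; congr (_%:R).
have -> : (e == gring_index G (enum_val i * (enum_val a)^-1)%g) = (i == a).
  apply/eqP/eqP=> [|->]; last by rewrite mulgV.
  move/(can_in_inj (@gring_indexK _ G)); rewrite groupM ?groupV ?enum_valP //.
  by move/(_ (group1 _) isT)/esym/eqP; rewrite -eq_mulgV1 => /eqP/enum_val_inj.
by [].
Qed.

Definition dual_mx M x := (M x^-1%g)^T.

Lemma dual_mx_repr M : mx_repr G (dual_mx M).
Proof.
split=> [|x y Gx Gy]; first by rewrite /dual_mx invg1 repr_mx1 trmx1.
by rewrite /dual_mx invMg repr_mxM ?groupV // trmx_mul.
Qed.
Definition dual M : module := Representation (MxRepresentation (dual_mx_repr M)).

Lemma traceable_dual M : traceable M -> traceable (dual M).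
Proof.
move=> [s s1]; exists s^T; rewrite -[RHS]trmx1 -s1 linear_sum /=.
by apply: eq_bigr => x _; rewrite /= /dual_mx !trmx_mul mulmxA invgK.
Qed.

Lemma hull_emb_split M : exists r, hull_emb M *m r = 1%:M.
Proof.
pose e := gring_index G 1.
exists (\matrix_(j, i) (mxtens_unindex j == (i, e))%:R).
apply/matrixP=> i i'; rewrite !mxE (bigD1 (mxtens_index (i, e))) //=.
rewrite !mxE mxtens_indexK /= eqxx mul1r xpair_eqE eqxx andbT.
rewrite big1 ?addr0 // => j; case: (mxtens_indexP j) => j1 j2 ne.
rewrite !mxE mxtens_indexK /= -natrM mulnb xpair_eqE.
have [ij1|] //= := eqVneq i j1; have [j2e|] := eqVneq j2 e; last by rewrite andbF.
by rewrite ij1 j2e eqxx in ne.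
Qed.

Lemma traceable_hull M : traceable (inj_hull M).
Proof. exact: traceable_tensr traceable_regular. Qed.

(** A projective module is a retract of every module that maps onto it, so it
suffices to map a traceable one onto it. *)
Lemma projectiveP P : traceable P <-> projective P.
Proof.
split=> [tP M N g f /row_fullP[r rg]|pP].
  have [h eh hg] :=
    traceable_projective tP (@mx_of_homP _ _ _ _ _ g) (@mx_of_homP _ _ _ _ _ f) rg.
  by exists (ModHom eh).
(* P is a quotient of the dual of the injective hull of its dual *)
pose D := dual (inj_hull (dual P)); pose q := (hull_emb (dual P))^T.
have eq_q x : x \in G -> D x *m q = q *m P x.
  move=> Gx; rewrite -[P x]trmxK -trmx_mul -trmx_mul; congr (_^T).
  by have := mx_of_homP (hull_emb (dual P)) (groupVr Gx); rewrite /= /dual_mx invgK.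
have [r rE] := hull_emb_split (dual P).
have tD : traceable D by apply/traceable_dual/traceable_hull.
have full_q : row_full q.
  by apply/row_fullP; exists r^T; rewrite -trmx_mul rE trmx1.
have [h hq] := pP _ _ (@ModHom _ _ _ D P q eq_q) (id_hom P) full_q.
exact: (traceable_retract (@mx_of_homP _ _ _ _ _ h) eq_q hq).
Qed.

(** A transfer [transfer M N s] factors through the hull of [M]: with [r] a
linear retraction of [hull_emb M], it is [hull_emb M] followed by the transfer
of [r *m s]. *)
Lemma stable_eqP M N (f g : mod_hom M N) :
  stable_eq f g <-> stably_eq M N f g.
Proof.
split=> [[P [a [b [/projectiveP tP fg]]]]|[s fg]].
  exact: factor_stably_eq tP (mx_of_homP a) (mx_of_homP b) fg.
have [r rE] := hull_emb_split M.
exists (inj_hull M), (hull_emb M), (ModHom (@transfer_equiv _ N (r *m s))).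
split; first by apply/projectiveP/traceable_hull.
rewrite fg [RHS](transferMl _ (@mx_of_homP _ _ _ _ _ (hull_emb M))).
by rewrite mulmxA rE mul1mx.
Qed.

End Transfer.
Arguments transfer {k gT G} M N s.
Arguments equivariant {k gT G} M N f.
Arguments stably_eq {k gT G} M N f g.

(** * Extensions, pushouts and standard triangles *)

Section MatrixExact.
Variable k : fieldType.

(** Any section [t] of [g] can be corrected to one that is killed by [s]. *)
Lemma split_exactI a b c (f : 'M[k]_(a, b)) (g : 'M_(b, c)) s t A :
  f *m s = 1%:M -> t *m g = 1%:M -> f *m g = 0 -> 1%:M - g *m t = A *m f ->
  split_exact f g.
Proof.
move=> fs tg fg gtA; exists s, (t - t *m s *m f); split=> //.
  by rewrite mulmxBl tg -(mulmxA _ f) fg mulmx0 subr0.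
have gtE : g *m t = 1%:M - A *m f by rewrite -gtA opprB addrC subrK.
rewrite mulmxBr !mulmxA gtE mulmxBl mul1mx -(mulmxA A f s) fs mulmx1.
by rewrite mulmxBl opprB addrC addrA subrK subrK.
Qed.

Lemma split_exact_tensl a b c d (f : 'M[k]_(a, b)) (g : 'M_(b, c)) :
  split_exact f g -> split_exact (f *t (1%:M : 'M[k]_d)) (g *t (1%:M : 'M_d)).
Proof.
move=> [s [t [fs tg fg stE]]]; exists (s *t 1%:M), (t *t 1%:M).
by split; rewrite !tensmx_mul !mulmx1 -?tensmxDl ?fs ?tg ?fg ?stE
  ?tens0mx ?tens1mx1.
Qed.

End MatrixExact.

Section Triangles.
Variables (k : fieldType) (gT : finGroupType) (G : {group gT}).
Local Notation module := (representation k G).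
Implicit Types L M N X Y Z I : module.

Lemma epi_equiv X Y Z (g : mod_hom X Y) t (h : 'M_(rdegree Y, rdegree Z)) :
  t *m g = 1%:M -> equivariant X Z (g *m h) -> equivariant Y Z h.
Proof.
move=> tg egh x Gx; rewrite -[Y x]mul1mx -tg -(mulmxA t) -mx_of_homP //.
by rewrite -!mulmxA egh // !mulmxA tg mul1mx.
Qed.

Lemma mono_equiv X Y Z (g : mod_hom Y Z) s (h : 'M_(rdegree X, rdegree Y)) :
  g *m s = 1%:M -> equivariant X Z (h *m g) -> equivariant X Y h.
Proof.
move=> gs ehg x Gx; rewrite -[X in h *m X]mulmx1 -gs !(mulmxA, mx_of_homP) //.
rewrite -(mulmxA h) mx_of_homP // (mulmxA h) -ehg //.
by rewrite mulmxA -!(mulmxA _ g s) gs mulmx1.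
Qed.

Lemma split_exact_factor X Y Z W (f : mod_hom X Y) (g : mod_hom Y Z) (h : mod_hom Y W) :
  split_exact f g -> f *m h = 0 -> exists h' : mod_hom Z W, g *m h' = h.
Proof.
move=> [s [t [fs tg fg stE]]] fh.
have ghE : g *m (t *m h) = h.
  by rewrite mulmxA -[RHS]mul1mx -stE mulmxDl -(mulmxA s) fh mulmx0 add0r.
suff eh : equivariant Z W (t *m h) by exists (ModHom eh).
by apply: (epi_equiv tg); rewrite ghE; apply: mx_of_homP.
Qed.

(** A morphism from the extension I of S by X to the extension Z of S by Y that
is the identity on S.  The left-hand square is then a pushout, and conversely
(see [extension_map_pushout] and [pushout_extension_map]), but this form is
visibly preserved by exact functors. *)
Definition extension_map X I S Y Z (i : mod_hom X I) (p : mod_hom I S)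
    (u : mod_hom X Y) (v : mod_hom Y Z) (w : mod_hom Z S) (c : mod_hom I Z) :=
  [/\ split_exact i p, split_exact v w, i *m c = u *m v & c *m w = p].

Section Extension.
Variables (X I S Y Z : module) (i : mod_hom X I) (p : mod_hom I S).
Variables (u : mod_hom X Y) (v : mod_hom Y Z) (w : mod_hom Z S) (c : mod_hom I Z).

(** The image of [c] meets every class modulo Y, so Y and I together span Z. *)
Lemma extension_map_epi : extension_map i p u v w c ->
  exists a b, a *m v + b *m c = 1%:M.
Proof.
move=> [[si [ti [_ tp _ _]]] [s [t [_ tw vw stE]]] _ cw].
exists (s - w *m ti *m c *m s), (w *m ti).
rewrite mulmxBl -(mulmxA _ s v).
have -> : s *m v = 1%:M - w *m t by rewrite -stE addrK.
rewrite mulmxBr mulmx1 -!mulmxA (mulmxA c) cw (mulmxA ti) tp mul1mx.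
by rewrite opprB addrA !subrK.
Qed.

Lemma extension_map_ext W (f g : 'M_(rdegree Z, W)) :
  extension_map i p u v w c -> v *m f = v *m g -> c *m f = c *m g -> f = g.
Proof.
case/extension_map_epi=> a [b ab] vfg cfg.
by rewrite -[f]mul1mx -[g]mul1mx -ab !mulmxDl -!mulmxA vfg cfg.
Qed.

(** The universal property of the pushout.  The section [ti *m c] of [w] comes
from a section of [p]; relative to the splitting of Z that it determines, the
map glued from [d] and [b] is [d] on Y and [ti *m b] on S. *)
Lemma extension_map_desc E (b : mod_hom I E) (d : mod_hom Y E) :
  extension_map i p u v w c -> i *m b = u *m d ->
  exists2 e : mod_hom Z E, c *m e = b & v *m e = d.
Proof.
move=> ext ibud; have ext0 := ext.
case: ext0 => -[si [ti [isi tp ip stiE]]] [s [t [vs tw vw stE]]] icuv cw.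
(* [s'] is the retraction of [v] whose kernel is the image of [ti *m c] *)
pose s' := s - w *m ti *m c *m s; pose e := s' *m d + w *m ti *m b.
have s'v : s' *m v = 1%:M - w *m ti *m c.
  rewrite mulmxBl -(mulmxA _ s v).
  have -> : s *m v = 1%:M - w *m t by rewrite -stE addrK.
  rewrite mulmxBr mulmx1 -!mulmxA (mulmxA c) cw (mulmxA ti) tp mul1mx.
  by rewrite opprB addrA subrK.
have ve : v *m e = d.
  rewrite mulmxDr !mulmxA vw !mul0mx addr0 mulmxBr !mulmxA vw !mul0mx.
  by rewrite subr0 vs mul1mx.
have cs' : c *m s' = si *m u.
  have inj_v A B : A *m v = B *m v :> 'M_(rdegree I, rdegree Z) -> A = B.
    by move=> AB; rewrite -[A]mulmx1 -[B]mulmx1 -vs !mulmxA AB.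
  apply: inj_v; rewrite -(mulmxA c) s'v mulmxBr mulmx1 !mulmxA cw.
  rewrite -(mulmxA si) -icuv mulmxA -[X in X - _]mul1mx -mulmxBl -stiE.
  by rewrite addrK.
have ce : c *m e = b.
  rewrite mulmxDr !mulmxA cs' cw -(mulmxA si) -ibud mulmxA -mulmxDl stiE.
  by rewrite mul1mx.
have ee : equivariant Z E e.
  move=> x Gx; apply: (extension_map_ext ext).
    by rewrite !mulmxA ve -(mx_of_homP d) // -(mx_of_homP v) // -mulmxA ve.
  by rewrite !mulmxA ce -(mx_of_homP b) // -(mx_of_homP c) // -mulmxA ce.
by exists (ModHom ee).
Qed.

Lemma extension_map_pushout :
  extension_map i p u v w c -> is_pushout i u v c.
Proof.
move=> ext; split; first by case: ext.
move=> E b d ibud; have [e ce ve] := extension_map_desc ext ibud.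
exists e => // e' ce' ve'.
by apply: (extension_map_ext ext); rewrite ?ve ?ve' ?ce ?ce'.
Qed.

End Extension.

Section Construction.
Variables (X I S Y : module) (i : mod_hom X I) (p : mod_hom I S).
Variables (u : mod_hom X Y).
Variables (s : 'M[k]_(rdegree I, rdegree X)) (t : 'M[k]_(rdegree S, rdegree I)).
Hypotheses (is1 : i *m s = 1%:M) (tp1 : t *m p = 1%:M) (ip0 : i *m p = 0).
Hypothesis stE : s *m i + p *m t = 1%:M.

Let kappa x := t *m I x *m s.

(** The pushout of I along [u], on the space Y + S: the action is twisted by the
cocycle that measures the failure of [t] to be equivariant, pushed to Y. *)
Definition extension_mx x : 'M[k]_(rdegree Y + rdegree S) :=
  block_mx (Y x) 0 (kappa x *m u) (S x).

Let ts0 : t *m s = 0.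
Proof.
have ts0i : t *m s *m i = 0.
  apply/eqP; rewrite -mulmxA -(inj_eq (addIr (t *m (p *m t)))) -mulmxDr stE.
  by rewrite mulmx1 mulmxA tp1 mul1mx add0r.
by rewrite -[LHS]mulmx1 -is1 mulmxA ts0i mul0mx.
Qed.

Let kappaM x y : x \in G -> y \in G ->
  kappa (x * y) = kappa x *m X y + S x *m kappa y.
Proof.
move=> Gx Gy; rewrite /kappa repr_mxM // mulmxA -[in LHS](mulmx1 (t *m I x)).
rewrite -stE mulmxDr !mulmxDl; congr (_ + _).
  rewrite -!mulmxA; congr (_ *m (_ *m (_ *m _))).
  by rewrite mulmxA -mx_of_homP // -mulmxA is1 mulmx1.
by rewrite -(mulmxA t (I x)) (mulmxA (I x)) mx_of_homP // !mulmxA tp1 mul1mx.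
Qed.

Lemma extension_mx_repr : mx_repr G extension_mx.
Proof.
split=> [|x y Gx Gy]; rewrite /extension_mx.
  by rewrite !repr_mx1 /kappa repr_mx1 mulmx1 ts0 mul0mx -scalar_mx_block.
rewrite mulmx_block !mul0mx !mulmx0 !addr0 add0r !repr_mxM //; congr block_mx.
by rewrite kappaM // mulmxDl -!mulmxA (mx_of_homP u).
Qed.
Definition extension_module : module :=
  Representation (MxRepresentation extension_mx_repr).

Lemma ext_inl_equiv : equivariant Y extension_module (row_mx 1%:M 0).
Proof.
move=> x Gx; rewrite mul_mx_row mul_row_block.
by rewrite !mulmx1 !mulmx0 !mul1mx !mul0mx !addr0.
Qed.

Lemma ext_outr_equiv : equivariant extension_module S (col_mx 0 1%:M).
Proof.
move=> x Gx; rewrite [RHS]mul_col_mx [LHS]mul_block_col.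
by rewrite !mulmx1 !mulmx0 !mul1mx !mul0mx !add0r.
Qed.

Lemma ext_mid_equiv : equivariant I extension_module (row_mx (s *m u) p).
Proof.
move=> x Gx; rewrite mul_mx_row mul_row_block mulmx0 add0r mx_of_homP //.
congr row_mx; rewrite /kappa !mulmxA.
rewrite -(mulmxA s u) -(mx_of_homP u) // mulmxA -mulmxDl; congr (_ *m u).
rewrite -[I x in LHS]mul1mx -stE mulmxDl mulmxDl -!mulmxA; congr (_ + _).
by rewrite (mulmxA i) -mx_of_homP // -mulmxA is1 mulmx1.
Qed.

Lemma extension_map_build : extension_map i p u
  (@ModHom _ _ _ Y extension_module _ ext_inl_equiv) (ModHom ext_outr_equiv)
  (ModHom ext_mid_equiv).
Proof.
split=> /=.
- by exists s, t.
- exists (col_mx 1%:M 0), (row_mx 0 1%:M); split.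
  + by rewrite mul_row_col mulmx1 mulmx0 addr0.
  + by rewrite mul_row_col mulmx1 mulmx0 add0r.
  + by rewrite mul_row_col mulmx0 mul0mx addr0.
  + rewrite !mul_col_row !mulmx1 !mulmx0 add_block_mx !addr0 !add0r.
    by rewrite -scalar_mx_block.
- by rewrite !mul_mx_row mulmxA is1 mul1mx ip0 mulmx1 mulmx0.
- by rewrite mul_row_col mulmx0 mulmx1 add0r.
Qed.

End Construction.

Lemma extension_map_exists X I S Y (i : mod_hom X I) (p : mod_hom I S)
    (u : mod_hom X Y) : split_exact i p ->
  exists Z (v : mod_hom Y Z) (w : mod_hom Z S) (c : mod_hom I Z),
    extension_map i p u v w c.
Proof.
move=> [s [t [is1 tp1 ip0 stE]]].
by do 4!eexists; apply: (extension_map_build u is1 tp1 ip0 stE).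
Qed.

(** Two pushouts of the same maps are isomorphic, and the one constructed above
is an extension. *)
Lemma pushout_extension_map X I S Y Z (i : mod_hom X I) (p : mod_hom I S)
    (u : mod_hom X Y) (v : mod_hom Y Z) (w : mod_hom Z S) (c : mod_hom I Z) :
  split_exact i p -> is_pushout i u v c -> v *m w = 0 -> c *m w = p ->
  extension_map i p u v w c.
Proof.
move=> ip po vw cw; have [Z0 [v0 [w0 [c0 ext0]]]] := extension_map_exists u ip.
have [po_eq po_univ] := po; have [_ [s [t [vs tw vw0 stE]]] icuv0 cw0] := ext0.
have [d [cd vd] _] := po_univ _ _ _ icuv0.
have [d' cd' vd'] := extension_map_desc ext0 po_eq.
have [e [ce ve] eU] := po_univ _ _ _ po_eq.
have dd' : d *m d' = 1%:M.
  have -> : 1%:M = mx_of_hom e by apply: (eU (id_hom Z)); rewrite /= mulmx1.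
  by apply: (eU (comp_hom d' d)); rewrite /= mulmxA ?cd ?vd.
have d'd : d' *m d = 1%:M.
  apply: (extension_map_ext ext0).
    by rewrite mulmxA vd' vd mulmx1.
  by rewrite mulmxA cd' cd mulmx1.
have w0E : d' *m w = w0.
  by apply: (extension_map_ext ext0); rewrite mulmxA ?vd' ?cd' ?vw ?cw ?cw0 ?vw0.
split=> //; exists (d *m s), (t *m d'); split=> //.
- by rewrite mulmxA vd.
- by rewrite -mulmxA w0E.
have -> : mx_of_hom w = d *m w0 by rewrite -w0E mulmxA dd' mul1mx.
rewrite -vd' !mulmxA -(mulmxA d s) -(mulmxA d w0) -mulmxDl -mulmxDr stE.
by rewrite mulmx1 dd'.
Qed.

Lemma hull_exact X : split_exact (hull_emb X) (shift_proj X).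
Proof.
have [s es] := hull_emb_split X.
pose U := <<hull_emb X>>%MS.
have tg : (val_factmod (U := U) 1%:M) *m in_factmod U 1%:M = 1%:M.
  by rewrite -in_factmodE val_factmodK.
have fg : hull_emb X *m in_factmod U 1%:M = 0.
  by apply/eqP; rewrite -in_factmodE in_factmod_eq0 genmxE.
have : (1%:M - in_factmod U 1%:M *m val_factmod 1%:M <= hull_emb X)%MS.
  rewrite -(genmxE (hull_emb X)) -in_factmod_eq0 in_factmodE mulmxBl -mulmxA.
  by rewrite tg mul1mx mulmx1 subrr.
by case/submxP=> A; apply: split_exactI es tg fg.
Qed.

Lemma standard_triangleP X Y Z (u : mod_hom X Y) (v : mod_hom Y Z)
    (w : mod_hom Z (shift X)) :
  standard_triangle u v w <->
  exists c, extension_map (hull_emb X) (shift_proj X) u v w c.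
Proof.
split=> [[c [po vw cw]]|[c ext]]; exists c.
  exact: pushout_extension_map (hull_exact X) po vw cw.
split; [exact: extension_map_pushout ext | | by case: ext].
by case: ext => _ [s [t []]].
Qed.

End Triangles.

(** * Comparing extensions, and thick subcategories *)

Section Comparison.
Variables (k : fieldType) (gT : finGroupType) (G : {group gT}).
Local Notation module := (representation k G).
Implicit Types L M N X Y Z I : module.

Lemma equiv_hom M N (f : mod_hom M N) : equivariant M N f.
Proof. exact: mx_of_homP. Qed.
Hint Resolve equiv_hom : core.

Lemma equiv_subhom M N (f g : mod_hom M N) : equivariant M N (mx_of_hom f - mx_of_hom g).
Proof. exact: equivB. Qed.

Lemma split_exact_epi a b c d (f : 'M[k]_(a, b)) (g : 'M_(b, c)) (A B : 'M_(c, d)) :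
  split_exact f g -> g *m A = g *m B -> A = B.
Proof.
by move=> [s [t [_ tg _ _]]] gAB; rewrite -[A]mul1mx -[B]mul1mx -tg -!mulmxA gAB.
Qed.

Lemma comp_homE X Y Z (g : mod_hom Y Z) (f : mod_hom X Y) :
  mx_of_hom (comp_hom g f) = f *m g.
Proof. by []. Qed.

Lemma stable_isoP X Y (f : mod_hom X Y) : stable_iso f <->
  exists2 g : mod_hom Y X, stably_eq X X (f *m g) 1%:M & stably_eq Y Y (g *m f) 1%:M.
Proof.
split=> [[g /stable_eqP gf /stable_eqP fg]|[g gf fg]]; exists g => //.
  exact/stable_eqP.
exact/stable_eqP.
Qed.

(** An endomorphism of I that is the identity on X differs from 1 by a map that
factors through the quotient S. *)
Lemma endo_sub1_factor X I S (i : mod_hom X I) (p : mod_hom I S)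
    (e : mod_hom I I) : split_exact i p -> i *m e = i ->
  exists n : mod_hom S I, p *m n = mx_of_hom e - 1%:M.
Proof.
move=> ip ie; apply: (split_exact_factor (h := ModHom (equiv_subhom e (id_hom I))) ip).
by rewrite /= mulmxBr mulmx1 ie subrr.
Qed.

Section Compare.
Variables X Y I S Z J T W : module.
Variables (i : mod_hom X I) (p : mod_hom I S) (j : mod_hom X J) (q : mod_hom J T).
Variable u : mod_hom X Y.
Variables (v : mod_hom Y Z) (w : mod_hom Z S) (c : mod_hom I Z).
Variables (v' : mod_hom Y W) (w' : mod_hom W T) (c' : mod_hom J W).
Variables (e : mod_hom I J) (e' : mod_hom J I).

Lemma compare_shift (d : mod_hom S T) (d' : mod_hom T S) :
    split_exact i p -> traceable I -> i *m e = j -> j *m e' = i ->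
    p *m d = e *m q -> q *m d' = e' *m p ->
  stably_eq S S (d *m d') 1%:M.
Proof.
move=> ip tI ie je' pd qd'.
have [|n pn] := @endo_sub1_factor _ _ _ i p (comp_hom e' e) ip.
  by rewrite /= mulmxA ie je'.
apply: (factor_stably_eq (a := n) (b := p)) => //.
apply: (split_exact_epi ip); rewrite mulmxA pn /= mulmxBr mulmxBl mul1mx mulmx1.
by rewrite mulmxA pd -mulmxA qd' mulmxA.
Qed.

(** [d *m d'] and 1 agree on Y, and on I they differ by a map that factors
through S; hence the difference is a composite Z -> S -> I -> Z, and I is
projective. *)
Lemma compare_mid (d : mod_hom Z W) (d' : mod_hom W Z) :
    extension_map i p u v w c ->
    traceable I -> i *m e = j -> j *m e' = i ->
    v *m d = v' -> c *m d = e *m c' -> v' *m d' = v -> c' *m d' = e' *m c ->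
  stably_eq Z Z (d *m d') 1%:M.
Proof.
move=> ext tI ie je' vd cd vd' cd'; have [ip [? [? [_ _ vw _]]] _ cw] := ext.
have [|n pn] := @endo_sub1_factor _ _ _ i p (comp_hom e' e) ip.
  by rewrite /= mulmxA ie je'.
apply: (factor_stably_eq (a := comp_hom n w) (b := c)) => //.
apply: (extension_map_ext ext).
  by rewrite /= !mulmxA vw !mul0mx mulmxBr mulmx1 mulmxA vd vd' subrr.
rewrite /= !mulmxA cw pn /= mulmxBr mulmxBl mul1mx mulmx1.
by rewrite mulmxA cd -mulmxA cd' mulmxA.
Qed.

End Compare.

Lemma injective_ext X I S J (i : mod_hom X I) (p : mod_hom I S) (j : mod_hom X J) :
  split_exact i p -> traceable J -> exists e : mod_hom I J, i *m e = j.
Proof.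
move=> [s [_ [is1 _ _ _]]] tJ.
have [e ee ie] := traceable_injective tJ (equiv_hom i) (equiv_hom j) is1.
by exists (ModHom ee).
Qed.

Lemma induced_shift X I S J T (i : mod_hom X I) (p : mod_hom I S) (j : mod_hom X J)
    (q : mod_hom J T) (e : mod_hom I J) :
  split_exact i p -> j *m q = 0 -> i *m e = j ->
  exists d : mod_hom S T, p *m d = e *m q.
Proof.
move=> ip jq ie; apply: (split_exact_factor (h := comp_hom q e) ip).
by rewrite /= mulmxA ie.
Qed.

Lemma split_exact0 a b c (f : 'M[k]_(a, b)) (g : 'M_(b, c)) :
  split_exact f g -> f *m g = 0.
Proof. by case=> s [t []]. Qed.

Lemma shift_compare_iso X I S J T (i : mod_hom X I) (p : mod_hom I S)
    (j : mod_hom X J) (q : mod_hom J T) (e : mod_hom I J) (d : mod_hom S T) :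
    split_exact i p -> split_exact j q -> traceable I -> traceable J ->
    i *m e = j -> p *m d = e *m q ->
  stable_iso d.
Proof.
move=> ip jq tI tJ ie pd; have [e' je'] := injective_ext i jq tI.
have [d' qd'] := induced_shift jq (split_exact0 ip) je'.
apply/stable_isoP; exists d'.
  exact: compare_shift ip tI ie je' pd qd'.
exact: compare_shift jq tJ je' ie qd' pd.
Qed.

(** The cone of [u] is independent, up to stable isomorphism, of the injective
module into which X is embedded.  This is what lets induction, which sends the
hull of X to an injective module other than the hull of the induced module,
preserve triangles. *)
Lemma mid_compare_iso X Y I S Z J T W (i : mod_hom X I) (p : mod_hom I S)
    (j : mod_hom X J) (q : mod_hom J T) (u : mod_hom X Y)
    (v : mod_hom Y Z) (w : mod_hom Z S) (c : mod_hom I Z)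
    (v' : mod_hom Y W) (w' : mod_hom W T) (c' : mod_hom J W)
    (e : mod_hom I J) (d : mod_hom S T) :
    extension_map i p u v w c -> extension_map j q u v' w' c' ->
    traceable I -> traceable J -> i *m e = j -> p *m d = e *m q ->
  exists2 h : mod_hom Z W, stable_iso h & v *m h = v' /\ h *m w' = w *m d.
Proof.
move=> ext ext' tI tJ ie pd.
have [ip [? [? [_ _ vw _]]] icuv cw] := ext.
have [jq [? [? [_ _ vw' _]]] icuv' cw'] := ext'.
have [e' je'] := injective_ext i jq tI.
have [h ch vh] : exists2 h : mod_hom Z W, c *m h = comp_hom c' e & v *m h = v'.
  by apply: extension_map_desc ext _; rewrite /= mulmxA ie.
have [h' ch' vh'] : exists2 h : mod_hom W Z, c' *m h = comp_hom c e' & v' *m h = v.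
  by apply: extension_map_desc ext' _; rewrite /= mulmxA je'.
exists h; last first.
  split=> //; apply: (extension_map_ext ext).
    by rewrite mulmxA vh vw' mulmxA vw mul0mx.
  by rewrite mulmxA ch /= -mulmxA cw' mulmxA cw pd.
apply/stable_isoP; exists h'.
  exact: compare_mid ext tI ie je' vh ch vh' ch'.
exact: compare_mid ext' tJ je' ie vh' ch' vh ch.
Qed.

Definition exact_seq X Y Z :=
  exists (f : mod_hom X Y) (g : mod_hom Y Z), split_exact f g.

Lemma exact_seqI X Y Z (f : mod_hom X Y) (g : mod_hom Y Z) :
  split_exact f g -> exact_seq X Y Z.
Proof. by exists f, g. Qed.

Definition stable_retract X Y :=
  exists (i : mod_hom X Y) (r : mod_hom Y X), stably_eq X X (i *m r) 1%:M.

(** Thick subcategories of the stable category, described through short exact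
sequences of modules instead of triangles (see [thick_modulesP]). *)
Record thick_modules (P : set module) : Prop := {
  thick_traceable : forall X, traceable X -> P X;
  thick_summand : forall X Y, stable_retract X Y -> P Y -> P X;
  thick_exact : forall X Y Z, exact_seq X Y Z ->
    [/\ P X -> P Y -> P Z, P Y -> P Z -> P X & P X -> P Z -> P Y]
}.

Lemma traceable_quotient_iso X Y I (i : mod_hom I X) (q : mod_hom X Y) :
  split_exact i q -> traceable I ->
  exists2 r : mod_hom Y X, r *m q = 1%:M & stably_eq X X (q *m r) 1%:M.
Proof.
move=> iq tI; have [rho irho] := injective_ext (id_hom I) iq tI.
pose h := ModHom (equiv_subhom (id_hom X) (comp_hom i rho)).
have ih : i *m h = 0 by rewrite /= mulmxBr mulmx1 mulmxA irho mul1mx subrr.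
have [r qr] := split_exact_factor iq ih; exists r.
  apply: (split_exact_epi iq); rewrite mulmxA qr /= mulmxBl mul1mx -mulmxA.
  by rewrite (split_exact0 iq) mulmx0 subr0 mulmx1.
apply: stably_sym; apply: (factor_stably_eq (a := rho) (b := i)) => //.
by rewrite qr /= opprB addrC subrK.
Qed.

Lemma stable_iso_id X : stable_iso (id_hom X).
Proof. by apply/stable_isoP; exists (id_hom X); rewrite mulmx1; exact: stably_refl. Qed.

Lemma quot_homE M N (U : 'M_(rdegree M)) (V : 'M_(rdegree N))
    (modU : mxmodule M U) (modV : mxmodule N V) (f : mod_hom M N)
    (sUV : (U *m f <= V)%MS) :
  quot_proj modU *m quot_hom modU modV sUV = f *m quot_proj modV.
Proof.
change (in_factmod U 1%:M *m (val_factmod (U := U) 1%:M *m f *m in_factmod V 1%:M)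
  = f *m in_factmod V 1%:M).
have [A key] : exists A, in_factmod U 1%:M *m val_factmod (U := U) 1%:M - 1%:M = A *m U.
  apply/submxP; rewrite -in_factmod_eq0 in_factmodE mulmxBl mul1mx -mulmxA.
  by rewrite -[X in _ *m X - _]in_factmodE val_factmodK mulmx1 subrr.
have fV : U *m f *m in_factmod V 1%:M = 0.
  by apply/eqP; rewrite -in_factmodE in_factmod_eq0.
move: (in_factmod U _) (val_factmod _) (in_factmod V _) key fV => a b c key fV.
apply/eqP; rewrite -subr_eq0 !mulmxA -mulmxBl -[X in _ - X]mul1mx -mulmxBl key.
by rewrite -mulmxA -mulmxA (mulmxA U) fV mulmx0.
Qed.

Lemma shift_homE X Y (f : mod_hom X Y) :
  shift_proj X *m shift_hom f = (f *t 1%:M) *m shift_proj Y.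
Proof. exact: quot_homE. Qed.

Lemma shift_hom_id X : mx_of_hom (shift_hom (id_hom X)) = 1%:M.
Proof.
apply: (split_exact_epi (hull_exact X)); rewrite shift_homE mulmx1 tens1mx1.
exact: mul1mx.
Qed.

(** Push the extension Y of Z by X out along the hull of X.  The result W is an
extension of Z by an injective module, so it is stably Z; and the same square,
read in the other direction, is the pushout that defines the standard triangle
on [f]. *)
Lemma exact_seq_triangle X Y Z (f : mod_hom X Y) (g : mod_hom Y Z) :
  split_exact f g -> exists w, stable_triangle f g w.
Proof.
move=> fg; have [W [v [w [c ext]]]] := extension_map_exists (hull_emb X) fg.
have po : is_pushout (hull_emb X) f c v.
  have [poE po] := extension_map_pushout ext; split=> // E b d bd.
  have [h [ch vh] hU] := po E d b (esym bd); exists h => // h' ch' vh'.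
  exact: hU.
have [w' vw' cw'] : exists2 w' : mod_hom W (shift X),
    c *m w' = @ModHom _ _ _ Y (shift X) 0 (@equiv0 _ _ _ Y (shift X)) &
    v *m w' = shift_proj X.
  apply: extension_map_desc ext _.
  by rewrite /= mulmx0; apply/esym/split_exact0/hull_exact.
have std : standard_triangle f c w' by exists v.
have [_ vw _ cw] := ext.
have [r rw wr] := traceable_quotient_iso vw (@traceable_hull _ _ _ X).
exists (comp_hom w' r), X, Y, W, f, c, w', (id_hom X), (id_hom Y), r.
split=> //.
  split; try exact: stable_iso_id.
  by apply/stable_isoP; exists w => //; rewrite rw; exact: stably_refl.
split; apply/stable_eqP; rewrite !comp_homE.
- by rewrite mulmx1 mul1mx; exact: stably_refl.
- rewrite mul1mx -cw -mulmxA -[X in stably_eq _ _ _ X]mulmx1.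
  exact: stably_mul_l wr.
- by rewrite shift_hom_id mulmx1; exact: stably_refl.
Qed.

Lemma thick_modulesP (P : set (stable_category k G)) :
  thick_triangulated P <-> thick_modules P.
Proof.
split=> thP; split.
- move=> X tX; case: (thick_nonempty thP) => Y PY.
  apply: (thick_retract thP) PY.
  pose i := @ModHom _ _ _ X Y 0 (@equiv0 _ _ _ X Y).
  pose r := @ModHom _ _ _ Y X 0 (@equiv0 _ _ _ Y X).
  exists i, r; apply/stable_eqP; rewrite /= mulmx0.
  apply: stably_sym; apply: (factor_stably_eq tX (@equiv1 _ _ _ X) (@equiv1 _ _ _ X)).
  by rewrite mulmx1 subr0.
- move=> X Y [i [r ir]]; apply: (thick_retract thP).
  by exists i, r; apply/stable_eqP.
- move=> X Y Z [f [g /exact_seq_triangle[w]]]; exact: (thick_triangle thP).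
- exists (inj_hull (triv_module k G)); apply: (thick_traceable thP).
  exact: traceable_hull.
- move=> X.
  have [] := thick_exact thP (exact_seqI (hull_exact X)).
  have Ph : P (inj_hull X) by apply/(thick_traceable thP)/traceable_hull.
  by split; auto.
- move=> X Y Z u v w [X' [Y' [Z' [u' [v' [w' [a [b [c [std [ia ib ic] _]]]]]]]]]].
  have iso A B (f : mod_hom A B) : stable_iso f -> P A <-> P B.
    case/stable_isoP=> g fg gf; split; apply: (thick_summand thP).
      by exists g, f.
    by exists f, g.
  move/standard_triangleP: std => [c' [_ vw' _ _]].
  have [ZS YS YZ] := thick_exact thP (exact_seqI vw').
  have [S1 S2 _] := thick_exact thP (exact_seqI (hull_exact X')).
  have Ph : P (inj_hull X') by apply/(thick_traceable thP)/traceable_hull.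
  have := (iso _ _ _ ia, iso _ _ _ ib, iso _ _ _ ic).
  by case=> -[[? ?] [? ?]] [? ?]; split; auto.
- move=> X Y [i [r /stable_eqP ir]]; apply: (thick_summand thP).
  by exists i, r.
Qed.

End Comparison.

(** * Systems of imprimitivity *)

Section CosetSums.
Variables (gT : finGroupType) (G H : {group gT}).
Hypothesis sHG : H \subset G.

Lemma mem_rcosets_repr C : C \in rcosets H G ->
  repr C \in G /\ C = (H :* repr C)%g.
Proof.
case/rcosetsP=> x Gx ->; have [y Hy] := repr_rcosetP H x.
split; first by rewrite groupM // (fintype.subsetP sHG).
by apply/rcoset_eqP; rewrite mem_rcoset invMg mulKVg groupV.
Qed.

Lemma rcosets_reprE x C : x \in G -> C \in rcosets H G ->
  (x * (repr C)^-1 \in H)%g = (C == H :* x)%g.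
Proof.
move=> Gx /mem_rcosets_repr[_ CE]; rewrite -mem_rcoset.
by apply/rcoset_eqP/eqP=> [->|<-].
Qed.

Lemma rcosets_sum_pick (V : nmodType) x (F : {set gT} -> V) : x \in G ->
  \sum_(C in rcosets H G) (if (x * (repr C)^-1)%g \in H then F C else 0)
    = F (H :* x)%g.
Proof.
move=> Gx; have HxG : (H :* x)%g \in rcosets H G by apply/rcosetsP; exists x.
rewrite (bigD1 (H :* x)%g) //= rcosets_reprE // eqxx big1 ?addr0 // => C.
by case/andP=> CG neC; rewrite rcosets_reprE // (negPf neC).
Qed.

Lemma rcosets_sum_translate (V : nmodType) g (F : gT -> V) : g \in G ->
    (forall h x, h \in H -> x \in G -> F (h * x)%g = F x) ->
  \sum_(C in rcosets H G) F (repr C * g)%g = \sum_(C in rcosets H G) F (repr C).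
Proof.
move=> Gg FH; rewrite [RHS](reindex_onto (fun C => C :* g)%g (fun C => C :* g^-1)%g) /=.
  apply: eq_big => [C|C CG].
    rewrite -rcosetM mulgV rcoset1 eqxx andbT.
    apply/rcosetsP/rcosetsP=> -[x Gx E].
      by exists (x * g)%g; rewrite ?groupM // E rcosetM.
    exists (x * g^-1)%g; rewrite ?groupM ?groupV //.
    by rewrite rcosetM -E -rcosetM mulgV rcoset1.
  have [GC CE] := mem_rcosets_repr CG.
  rewrite {2}CE -rcosetM; have [y Hy] := repr_rcosetP H (repr C * g)%g.
  by rewrite FH // groupM.
by move=> C _; rewrite -rcosetM mulVg rcoset1.
Qed.

End CosetSums.

Section Imprimitivity.
Variables (k : fieldType) (gT : finGroupType) (G H : {group gT}).
Hypothesis sHG : H \subset G.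
Implicit Types (M N : representation k H) (V W : representation k G).

(** A system of imprimitivity: V contains a copy of M, with an H-equivariant
projection onto it, and is the direct sum of the translates of this copy over
the right cosets of H.  It determines V up to isomorphism ([induced_iso]), and
all that is needed about induction follows from it, so the quotient that defines
induced modules has to be inspected only once. *)
Record induced_data M V := InducedData {
  ind_in : 'M[k]_(rdegree M, rdegree V);
  ind_out : 'M[k]_(rdegree V, rdegree M);
  ind_inP : forall h, h \in H -> M h *m ind_in = ind_in *m V h;
  ind_outP : forall h, h \in H -> V h *m ind_out = ind_out *m M h;
  ind_in_out : forall x, x \in G ->
    ind_in *m V x *m ind_out = if x \in H then M x else 0;
  ind_out_in : \sum_(C in rcosets H G)
    V (repr C)^-1%g *m ind_out *m ind_in *m V (repr C) = 1%:M
}.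

Section Map.
Variables (M N : representation k H) (V W : representation k G).
Variables (DV : induced_data M V) (DW : induced_data N W).

(** Induction of maps, one coset at a time.  It makes sense for maps that are
linear only, where it depends on the representatives of the cosets but remains
multiplicative; so linear splittings can be induced ([ind_map_exact]). *)
Definition ind_map (s : 'M[k]_(rdegree M, rdegree N)) : 'M_(rdegree V, rdegree W) :=
  \sum_(C in rcosets H G)
    V (repr C)^-1%g *m ind_out DV *m s *m ind_in DW *m W (repr C).

Lemma ind_mapD r s : ind_map (r + s) = ind_map r + ind_map s.
Proof. by rewrite -big_split /=; apply: eq_bigr => C _; rewrite mulmxDr !mulmxDl. Qed.

Lemma ind_map0 : ind_map 0 = 0.
Proof. by apply: big1 => C _; rewrite mulmx0 !mul0mx. Qed.

Lemma ind_map_unique s (f : 'M_(rdegree V, rdegree W)) :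
  equivariant V W f -> ind_in DV *m f = s *m ind_in DW -> f = ind_map s.
Proof.
move=> ef fs; rewrite -[LHS]mul1mx -(ind_out_in DV) mulmx_suml.
apply: eq_bigr => C /(mem_rcosets_repr sHG)[GC _].
by rewrite -(mulmxA _ s) -fs -!mulmxA ef.
Qed.

Lemma ind_map_equiv s : (forall h, h \in H -> M h *m s = s *m N h) ->
  equivariant V W (ind_map s).
Proof.
move=> es g Gg.
pose F x := V (g * x^-1)%g *m ind_out DV *m s *m ind_in DW *m W x.
transitivity (\sum_(C in rcosets H G) F (repr C)).
  rewrite mulmx_sumr; apply: eq_bigr => C /(mem_rcosets_repr sHG)[GC _].
  by rewrite /F !mulmxA repr_mxM ?groupV.
rewrite -(rcosets_sum_translate sHG Gg).
  rewrite mulmx_suml; apply: eq_bigr => C /(mem_rcosets_repr sHG)[GC _].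
  by rewrite /F invMg mulKVg -[in RHS]mulmxA repr_mxM.
move=> h x Hh Gx; have Gh := fintype.subsetP sHG h Hh.
rewrite /F invMg mulgA (repr_mxM W) // (repr_mxM V) ?groupM ?groupV //.
rewrite -!mulmxA; congr (_ *m _).
rewrite (mulmxA (V _)) ind_outP ?groupV // -!mulmxA; congr (_ *m _).
rewrite (mulmxA (M _)) es ?groupV // -!mulmxA; congr (_ *m _).
by rewrite (mulmxA (N _)) ind_inP ?groupV // -!mulmxA repr_mulVK.
Qed.

End Map.

Lemma ind_mapM M N L V W U (DV : induced_data M V) (DW : induced_data N W)
    (DU : induced_data L U) r s :
  ind_map DV DW r *m ind_map DW DU s = ind_map DV DU (r *m s).
Proof.
rewrite mulmx_suml; apply: eq_bigr => C /(mem_rcosets_repr sHG)[GC CE].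
rewrite mulmx_sumr (eq_bigr (fun D => if (repr C * (repr D)^-1)%g \in H then
  V (repr C)^-1%g *m ind_out DV *m r *m N (repr C * (repr D)^-1)%g *m s
    *m ind_in DU *m U (repr D) else 0)) => [|D /(mem_rcosets_repr sHG)[GD _]].
  rewrite (rcosets_sum_pick sHG) // -CE mulgV repr_mx1 mulmx1.
  by rewrite -!mulmxA.
have := ind_in_out DW (groupM GC (groupVr GD)).
rewrite repr_mxM ?groupV // -!mulmxA !(mulmxA (W _)) => /(congr1 (fun X =>
  V (repr C)^-1%g *m ind_out DV *m r *m X *m s *m ind_in DU *m U (repr D))).
by rewrite !mulmxA => ->; case: ifP; rewrite ?mulmx0 ?mul0mx.
Qed.

Lemma ind_map1 M V (D : induced_data M V) : ind_map D D 1%:M = 1%:M.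
Proof. by rewrite -[RHS](ind_out_in D); apply: eq_bigr => C _; rewrite mulmx1. Qed.

Lemma ind_map_exact M N L V W U (DV : induced_data M V) (DW : induced_data N W)
    (DU : induced_data L U) f g :
  split_exact f g -> split_exact (ind_map DV DW f) (ind_map DW DU g).
Proof.
move=> [s [t [fs tg fg stE]]]; exists (ind_map DW DV s), (ind_map DU DW t).
by rewrite !ind_mapM -ind_mapD fs tg fg stE !ind_map1 ind_map0.
Qed.

(** Apply [s] on the copy of M and zero on its other translates.  On M, the sum
over G of the conjugates of this map reduces to the sum over H, which is 1; and
a G-map that is 1 on M is 1. *)
Lemma induced_traceable M V (D : induced_data M V) : traceable M -> traceable V.
Proof.
move=> [s s1]; exists (ind_out D *m s *m ind_in D).
rewrite -(ind_map1 D); apply: ind_map_unique; first exact: transfer_equiv.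
rewrite mul1mx mulmx_sumr (bigID (mem H)) /= [X in _ + X]big1 ?addr0; last first.
  move=> x /andP[Gx nHx].
  by rewrite !mulmxA ind_in_out ?groupV // (negPf nHx) !mul0mx.
rewrite -[RHS]mul1mx -s1 mulmx_suml; apply: eq_big => [x|x /andP[Gx Hx]].
  by rewrite andb_idl //; apply: (fintype.subsetP sHG).
by rewrite !mulmxA ind_in_out ?groupV // Hx -!mulmxA ind_inP.
Qed.

End Imprimitivity.

(** * The induced module *)

Section TensorRows.
Variable k : fieldType.

(** The inclusion v |-> v (x) e_a, used to check identities between maps out of
a tensor product without unfolding it to entries. *)
Definition tens_row m n (a : 'I_n) : 'M[k]_(m, m * n) :=
  \matrix_(i, j) (mxtens_unindex j == (i, a))%:R.

Lemma tens_rowE m n p (a : 'I_n) (X : 'M_(m * n, p)) i j :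
  (tens_row m a *m X) i j = X (mxtens_index (i, a)) j.
Proof.
rewrite mxE (bigD1 (mxtens_index (i, a))) //= mxE mxtens_indexK eqxx mul1r.
rewrite big1 ?addr0 // => l; rewrite mxE.
case: (mxtens_indexP l) => l1 l2 ne; rewrite mxtens_indexK.
by rewrite (inj_eq (can_inj (@mxtens_indexK _ _))) in ne; rewrite (negPf ne) mul0r.
Qed.

Lemma tens_row_ext m n p (X Y : 'M_(m * n, p)) :
  (forall a : 'I_n, tens_row m a *m X = tens_row m a *m Y) -> X = Y.
Proof.
move=> XY; apply/matrixP=> l j; case: (mxtens_indexP l) => i a.
by rewrite -!tens_rowE XY.
Qed.

Lemma tens_row_tens m n p q (a : 'I_n) b (A : 'M_(m, p)) (B : 'M_(n, q)) :
  row a B = delta_mx 0 b -> tens_row m a *m (A *t B) = A *m tens_row p b.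
Proof.
move/rowP=> Ba; apply/matrixP=> i j; rewrite tens_rowE.
case: (mxtens_indexP j) => j1 j2; rewrite tensmxE; have := Ba j2.
rewrite !mxE eqxx /= => ->; rewrite (bigD1 j1) //= !mxE mxtens_indexK.
rewrite xpair_eqE eqxx /= big1 ?addr0 // => l /negPf nl.
by rewrite !mxE mxtens_indexK xpair_eqE eq_sym nl mulr0.
Qed.

Lemma tens_row_tr m n (a b : 'I_n) :
  tens_row m a *m (tens_row m b)^T = if a == b then 1%:M else 0.
Proof.
apply/matrixP=> i j; rewrite tens_rowE !mxE mxtens_indexK xpair_eqE.
by case: (a == b); rewrite ?andbT ?andbF !mxE.
Qed.

End TensorRows.

Section InducedModule.
Variables (k : fieldType) (gT : finGroupType) (G H : {group gT}).
Hypothesis sHG : H \subset G.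
Implicit Types M N : representation k H.

Let subHG h (Hh : h \in H) : h \in G := fintype.subsetP sHG h Hh.
Local Notation idx := (gring_index G).

Definition elt_row M x := tens_row k (rdegree M) (idx x).

(** Locked, for the quotient map is defined as a product of matrices, which
rewriting with associativity would otherwise expose. *)
Definition ind_proj M : mod_hom (free_module G M) (ind sHG M) :=
  locked (quot_proj (balanced_rel_mod sHG M)).

Lemma ind_projE M :
  mx_of_hom (ind_proj M) = in_factmod (balanced_rel G M) 1%:M.
Proof. by rewrite /ind_proj -lock. Qed.

Lemma elt_row_ext M p (X Y : 'M_(rdegree M * #|G|, p)) :
  (forall x, x \in G -> elt_row M x *m X = elt_row M x *m Y) -> X = Y.
Proof.
move=> XY; apply: tens_row_ext => a.
by have := XY _ (enum_valP a); rewrite /elt_row gring_valK.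
Qed.

Lemma elt_row_free M x y : x \in G -> y \in G ->
  elt_row M x *m free_module G M y = elt_row M (x * y)%g.
Proof.
move=> Gx Gy; rewrite -[RHS]mul1mx; apply: tens_row_tens.
by rewrite rowK gring_indexK.
Qed.

Lemma elt_row_map M N x (f : 'M_(rdegree M, rdegree N)) :
  elt_row M x *m (f *t 1%:M) = f *m elt_row N x.
Proof.
apply: tens_row_tens; apply/rowP=> j; rewrite !mxE eqxx /=.
by rewrite eq_sym.
Qed.

Lemma elt_row_lreg M x h : x \in G -> h \in G ->
  elt_row M x *m (1%:M *t lreg_mx k G h) = elt_row M (h * x)%g.
Proof.
move=> Gx Gh; rewrite -[RHS]mul1mx; apply: tens_row_tens.
by rewrite rowK gring_indexK.
Qed.

(** The map M (x) kG -> M sending v (x) g to v g for g in H, and to 0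
otherwise. *)
Definition free_out M : 'M[k]_(rdegree M * #|G|, rdegree M) :=
  \sum_(h in H) (elt_row M h)^T *m M h.

Lemma elt_row_out M x : x \in G ->
  elt_row M x *m free_out M = if x \in H then M x else 0.
Proof.
move=> Gx; have eqx h : h \in H -> (idx x == idx h) = (x == h).
  by move=> Hh; rewrite (can_in_eq (@gring_indexK _ G)) // subHG.
rewrite mulmx_sumr; case: ifPn => [Hx|nHx].
  rewrite (bigD1 x) //= mulmxA tens_row_tr eqxx mul1mx big1 ?addr0 // => h.
  by case/andP=> Hh /negPf ne; rewrite mulmxA tens_row_tr eqx // eq_sym ne mul0mx.
apply: big1 => h Hh; rewrite mulmxA tens_row_tr eqx //.
by case: eqP nHx => [->|_ _]; [rewrite Hh | rewrite mul0mx].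
Qed.

Lemma balanced_out M : balanced_rel G M *m free_out M = 0.
Proof.
apply/sub_kermxP; apply/sumsmx_subP=> h Hh; apply/sub_kermxP.
apply: elt_row_ext => x Gx; rewrite mulmx0 mulmxA mulmxBr.
have Gh := subHG Hh; rewrite elt_row_map elt_row_lreg // mulmxBl -mulmxA.
rewrite (elt_row_out M Gx) (elt_row_out M (groupM Gh Gx)) groupMl //.
by case: ifP => Hx; rewrite ?mulmx0 ?subrr // repr_mxM // subrr.
Qed.

Lemma balanced_proj M h : h \in H ->
  (M h *t 1%:M) *m ind_proj M = (1%:M *t lreg_mx k G h) *m ind_proj M.
Proof.
move=> Hh; apply/eqP; rewrite -subr_eq0 -mulmxBl ind_projE -in_factmodE in_factmod_eq0.
by apply: (sumsmx_sup h).
Qed.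

Definition ind_unit M := elt_row M 1%g *m ind_proj M.
Lemma ind_proj_full M : exists t, t *m ind_proj M = 1%:M.
Proof.
exists (val_factmod (U := balanced_rel G M) 1%:M).
by rewrite ind_projE -[LHS]in_factmodE val_factmodK.
Qed.

Lemma ind_proj_ext M p (X Y : 'M_(rdegree (ind sHG M), p)) :
  (forall x, x \in G ->
    elt_row M x *m ind_proj M *m X = elt_row M x *m ind_proj M *m Y) -> X = Y.
Proof.
move=> XY; have [t tp] := ind_proj_full M.
rewrite -[X]mul1mx -[Y]mul1mx -tp -!mulmxA; congr (_ *m _).
by apply: elt_row_ext => x Gx; rewrite !mulmxA XY.
Qed.

Definition ind_counit M : 'M_(rdegree (ind sHG M), rdegree M) :=
  locked (val_factmod (U := balanced_rel G M) 1%:M *m free_out M).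

Lemma ind_proj_counit M : ind_proj M *m ind_counit M = free_out M.
Proof.
rewrite /ind_counit -lock; set v := val_factmod _.
have [A key] : exists A, ind_proj M *m v - 1%:M = A *m balanced_rel G M.
  apply/submxP; rewrite -in_factmod_eq0 in_factmodE -ind_projE mulmxBl mul1mx.
  rewrite -mulmxA /v (ind_projE M) -[X in _ *m X - _]in_factmodE.
  by rewrite val_factmodK mulmx1 subrr.
move: v key => v key.
apply/eqP; rewrite -subr_eq0 mulmxA -[X in _ - X]mul1mx -mulmxBl key.
by rewrite -mulmxA balanced_out mulmx0.
Qed.

Lemma elt_row_act M x y : x \in G -> y \in G ->
  elt_row M x *m ind_proj M *m ind sHG M y = elt_row M (x * y)%g *m ind_proj M.
Proof.
move=> Gx Gy; rewrite -(mulmxA _ (ind_proj M)) -(mx_of_homP (ind_proj M) Gy).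
by rewrite mulmxA elt_row_free.
Qed.

Lemma ind_unit_act M x : x \in G ->
  ind_unit M *m ind sHG M x = elt_row M x *m ind_proj M.
Proof. by move=> Gx; rewrite elt_row_act // mul1g. Qed.

Lemma elt_row_balanced M h x : h \in H -> x \in G ->
  M h *m elt_row M x *m ind_proj M = elt_row M (h * x)%g *m ind_proj M.
Proof.
move=> Hh Gx; rewrite -elt_row_map -mulmxA balanced_proj // mulmxA.
by rewrite elt_row_lreg // subHG.
Qed.

Lemma ind_unitP M h : h \in H -> M h *m ind_unit M = ind_unit M *m ind sHG M h.
Proof.
by move=> Hh; rewrite mulmxA elt_row_balanced // mulg1 ind_unit_act ?subHG.
Qed.

Lemma ind_counitP M h : h \in H ->
  ind sHG M h *m ind_counit M = ind_counit M *m M h.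
Proof.
move=> Hh; have Gh := subHG Hh.
apply: ind_proj_ext => x Gx; rewrite [LHS]mulmxA elt_row_act //.
rewrite -(mulmxA _ (ind_proj M) (ind_counit M)).
rewrite -(mulmxA (elt_row M x) (ind_proj M) (ind_counit M *m M h)).
rewrite (mulmxA (ind_proj M)) ind_proj_counit (mulmxA (elt_row M x)).
rewrite (elt_row_out M Gx) (elt_row_out M (groupM Gx Gh)) groupMr //.
by case: ifP => Hx; rewrite ?mul0mx // repr_mxM.
Qed.

Lemma ind_unit_counit M x : x \in G ->
  ind_unit M *m ind sHG M x *m ind_counit M = if x \in H then M x else 0.
Proof.
move=> Gx; rewrite ind_unit_act // -(mulmxA _ (ind_proj M)) ind_proj_counit.
exact: elt_row_out.
Qed.

(** With x = h (repr C) and h in H, the balancing relations identify v (x) x with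
(v h) (x) (repr C), which is the translate of (v h) (x) 1 by [repr C]. *)
Lemma ind_counit_unit M : \sum_(C in rcosets H G) ind sHG M (repr C)^-1%g
  *m ind_counit M *m ind_unit M *m ind sHG M (repr C) = 1%:M.
Proof.
apply: ind_proj_ext => x Gx; rewrite mulmx1 mulmx_sumr.
rewrite (eq_bigr (fun C => if (x * (repr C)^-1)%g \in H then
   M (x * (repr C)^-1)%g *m (elt_row M (repr C)) *m ind_proj M else 0)).
  rewrite (rcosets_sum_pick sHG) // elt_row_balanced ?mulgKV //.
    by rewrite -mem_rcoset rcoset_sym mem_repr_rcoset.
  have HxG : (H :* x)%g \in rcosets H G by apply/rcosetsP; exists x.
  by have [] := mem_rcosets_repr sHG HxG.
move=> C /(mem_rcosets_repr sHG)[GC _].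
have GV := groupVr GC; rewrite -!(mulmxA (ind sHG M _)).
rewrite (mulmxA (elt_row M x *m _)) elt_row_act //.
rewrite -(mulmxA (ind_counit M)) (mulmxA _ (ind_counit M)).
rewrite -(mulmxA _ _ (ind_counit M)).
rewrite ind_proj_counit (elt_row_out _ (groupM Gx GV)).
case: ifP => _; last exact: mul0mx.
by rewrite -(mulmxA (M _)) -ind_unit_act.
Qed.

Definition ind_data M : induced_data M (ind sHG M) :=
  InducedData (@ind_unitP M) (@ind_counitP M) (@ind_unit_counit M)
    (ind_counit_unit M).

Lemma ind_homE M N (f : mod_hom M N) :
  mx_of_hom (ind_hom sHG f) = ind_map (ind_data M) (ind_data N) (mx_of_hom f).
Proof.
apply: ind_map_unique => //; first exact: equiv_hom.
have qE : ind_proj M *m ind_hom sHG f = (f *t 1%:M) *m ind_proj N.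
  by rewrite !ind_projE; apply: quot_homE.
change (ind_unit M *m ind_hom sHG f = f *m ind_unit N).
rewrite /ind_unit -(mulmxA _ (ind_proj M)) qE (mulmxA (elt_row M _)) elt_row_map.
by rewrite (mulmxA f).
Qed.

End InducedModule.

(** * Induction is exact *)

Section ExactInduction.
Variables (k : fieldType) (gT : finGroupType) (G H : {group gT}).
Hypothesis sHG : H \subset G.
Implicit Types X Y Z : representation k H.
Local Notation Ind := (ind sHG).
Local Notation "'Ind1' f" := (ind_hom sHG f) (at level 10, f at level 8).

Lemma ind_homM X Y Z (f : mod_hom X Y) (g : mod_hom Y Z) (h : mod_hom X Z) :
  f *m g = h -> Ind1 f *m Ind1 g = Ind1 h.
Proof. by move=> fg; rewrite !ind_homE (ind_mapM sHG) fg. Qed.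

Lemma ind_hom_square X Y Y' Z (f : mod_hom X Y) (g : mod_hom Y Z)
    (f' : mod_hom X Y') (g' : mod_hom Y' Z) :
  f *m g = f' *m g' -> Ind1 f *m Ind1 g = Ind1 f' *m Ind1 g'.
Proof. by move=> fg; rewrite !ind_homE !(ind_mapM sHG); congr (ind_map _ _ _). Qed.

Lemma ind_hom_exact X Y Z (f : mod_hom X Y) (g : mod_hom Y Z) :
  split_exact f g -> split_exact (Ind1 f) (Ind1 g).
Proof. by rewrite !ind_homE; apply: ind_map_exact. Qed.

Lemma ind_traceable X : traceable X -> traceable (Ind X).
Proof. exact: (induced_traceable sHG (ind_data sHG X)). Qed.

Lemma ind_hom_id X : mx_of_hom (Ind1 (id_hom X)) = 1%:M.
Proof. by rewrite ind_homE ind_map1. Qed.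

Lemma ind_stably_eq X Y (f g : mod_hom X Y) :
  stably_eq X Y f g -> stably_eq (Ind X) (Ind Y) (Ind1 f) (Ind1 g).
Proof.
case/stable_eqP=> P [a [b [/projectiveP tP fg]]].
apply: (factor_stably_eq (a := Ind1 a) (b := Ind1 b)) => //.
- exact: ind_traceable.
- exact: equiv_hom.
- exact: equiv_hom.
rewrite !ind_homE (ind_mapM sHG); apply/eqP; rewrite subr_eq -ind_mapD; apply/eqP.
by congr (ind_map _ _ _); apply/eqP; rewrite -subr_eq fg.
Qed.

Lemma ind_stable_iso X Y (f : mod_hom X Y) : stable_iso f -> stable_iso (Ind1 f).
Proof.
case/stable_isoP=> g fg gf; apply/stable_isoP; exists (Ind1 g).
  rewrite -(ind_hom_id X) (ind_homM (h := comp_hom g f)) //.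
  exact: (@ind_stably_eq _ _ (comp_hom g f) (id_hom X)).
rewrite -(ind_hom_id Y) (ind_homM (h := comp_hom f g)) //.
exact: (@ind_stably_eq _ _ (comp_hom f g) (id_hom Y)).
Qed.

(** The map induced on cokernels by an extension of [hull_emb (Ind X)] to the
induced hull.  The maps induced by two such extensions differ by one that factors
through an injective module, which is why this choice is natural stably
([ind_shift_nat]). *)
Lemma ind_shift_exists X :
  exists d : mod_hom (Ind (shift X)) (shift (Ind X)),
  exists e : mod_hom (Ind (inj_hull X)) (inj_hull (Ind X)),
    Ind1 (hull_emb X) *m e = hull_emb (Ind X) /\
    Ind1 (shift_proj X) *m d = e *m shift_proj (Ind X).
Proof.
have hX := ind_hom_exact (hull_exact X).
have [e ie] := injective_ext (hull_emb (Ind X)) hX (@traceable_hull _ _ _ (Ind X)).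
have [d pd] := induced_shift hX (split_exact0 (hull_exact (Ind X))) ie.
by exists d, e.
Qed.

Definition ind_shift X : mod_hom (Ind (shift X)) (shift (Ind X)) :=
  projT1 (cid (ind_shift_exists X)).

Lemma ind_shiftP X : exists2 e : mod_hom (Ind (inj_hull X)) (inj_hull (Ind X)),
  Ind1 (hull_emb X) *m e = hull_emb (Ind X) &
  Ind1 (shift_proj X) *m ind_shift X = e *m shift_proj (Ind X).
Proof. by have [e [ie pd]] := projT2 (cid (ind_shift_exists X)); exists e. Qed.

Lemma ind_shift_iso X : stable_iso (ind_shift X).
Proof.
have [e ie pd] := ind_shiftP X.
apply: (shift_compare_iso (ind_hom_exact (hull_exact X)) (hull_exact (Ind X)))
  ie pd; last exact: traceable_hull.
exact/ind_traceable/traceable_hull.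
Qed.

Lemma hull_embE (K : {group gT}) (X : representation k K) :
  mx_of_hom (hull_emb X) = \sum_a tens_row k (rdegree X) a.
Proof.
apply/matrixP=> i j; rewrite summxE !mxE.
case: (mxtens_indexP j) => j1 j2; rewrite mxtens_indexK (bigD1 j2) //=.
rewrite !mxE mxtens_indexK xpair_eqE eqxx andbT eq_sym big1 ?addr0 // => a.
by rewrite !mxE mxtens_indexK xpair_eqE eq_sym => /negPf->; rewrite andbF.
Qed.

Lemma hull_emb_nat (K : {group gT}) (X Y : representation k K) (f : mod_hom X Y) :
  hull_emb X *m (f *t 1%:M) = f *m hull_emb Y.
Proof.
rewrite !hull_embE mulmx_suml mulmx_sumr; apply: eq_bigr => a _.
by apply: tens_row_tens; apply/rowP=> j; rewrite !mxE eqxx eq_sym.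
Qed.

Lemma ind_shift_nat X Y (f : mod_hom X Y) :
  stably_eq (Ind (shift X)) (shift (Ind Y))
    (ind_shift X *m shift_hom (Ind1 f)) (Ind1 (shift_hom f) *m ind_shift Y).
Proof.
have [e ie pd] := ind_shiftP X; have [e' ie' pd'] := ind_shiftP Y.
have hX := ind_hom_exact (hull_exact X).
pose a := comp_hom (hull_hom (Ind1 f)) e; pose b := comp_hom e' (Ind1 (hull_hom f)).
have hom_sq : Ind1 (hull_emb X) *m Ind1 (hull_hom f) = Ind1 f *m Ind1 (hull_emb Y).
  by apply: ind_hom_square; apply: hull_emb_nat.
have shift_sq : Ind1 (shift_proj X) *m Ind1 (shift_hom f)
    = Ind1 (hull_hom f) *m Ind1 (shift_proj Y).
  by apply: ind_hom_square; apply: shift_homE.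
have [|n pn] := @split_exact_factor _ _ _ _ _ _ _ _ _ (ModHom (equiv_subhom a b)) hX.
  change (Ind1 (hull_emb X) *m (mx_of_hom a - mx_of_hom b) = 0).
  rewrite mulmxBr /a /b !comp_homE (mulmxA _ (mx_of_hom e)) ie hull_emb_nat.
  by rewrite (mulmxA _ (mx_of_hom (Ind1 _))) hom_sq -(mulmxA _ _ e') ie' subrr.
change (Ind1 (shift_proj X) *m n = mx_of_hom a - mx_of_hom b) in pn.
apply: (factor_stably_eq (a := n) (b := shift_proj (Ind Y))).
- exact: traceable_hull.
- exact: equiv_hom.
- exact: equiv_hom.
apply: (split_exact_epi hX); rewrite mulmxBr (mulmxA _ n) pn mulmxBl /a /b !comp_homE.
congr (_ - _).
  by rewrite (mulmxA _ (ind_shift X)) pd -!(mulmxA e) shift_homE.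
rewrite (mulmxA _ _ (ind_shift Y)) shift_sq -(mulmxA _ _ (ind_shift Y)) pd'.
by rewrite (mulmxA _ _ (shift_proj _)).
Qed.

Lemma stably_cancel (K : {group gT}) (X Y Z : representation k K) (f : mod_hom X Y)
    (g : mod_hom Y Z) (g' : mod_hom Z Y) (f' : mod_hom Y X) :
    stably_eq X X (f *m f') 1%:M -> stably_eq Y Y (g *m g') 1%:M ->
  stably_eq X X ((f *m g) *m (g' *m f')) 1%:M.
Proof.
move=> ff' gg'; apply: stably_trans ff'.
rewrite -mulmxA (mulmxA g) -[X in stably_eq _ _ _ (_ *m X)]mul1mx.
apply: stably_mul_l; first exact: equiv_hom.
by apply: stably_mul_r gg'; exact: equiv_hom.
Qed.

Lemma stable_iso_comp (K : {group gT}) (X Y Z : representation k K)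
    (g : mod_hom Y Z) (f : mod_hom X Y) :
  stable_iso f -> stable_iso g -> stable_iso (comp_hom g f).
Proof.
case/stable_isoP=> f' ff' f'f /stable_isoP[g' gg' g'g].
apply/stable_isoP; exists (comp_hom f' g'); rewrite !comp_homE.
  exact: stably_cancel.
exact: stably_cancel.
Qed.

Lemma stable_eq_mx (K : {group gT}) (M N : representation k K) (f g : mod_hom M N) :
  mx_of_hom f = mx_of_hom g -> stable_eq f g.
Proof. by move=> fg; apply/stable_eqP; rewrite fg; apply: stably_refl. Qed.

Lemma ind_triangle X Y Z (u : mod_hom X Y) (v : mod_hom Y Z)
    (w : mod_hom Z (shift X)) : stable_triangle u v w ->
  stable_triangle (Ind1 u) (Ind1 v) (comp_hom (ind_shift X) (Ind1 w)).
Proof.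
case=> X' [Y' [Z' [u' [v' [w' [a [b [c [std [ia ib ic] [ab bc ca]]]]]]]]]].
case/standard_triangleP: std => c' ext.
have iext : extension_map (Ind1 (hull_emb X')) (Ind1 (shift_proj X'))
    (Ind1 u') (Ind1 v') (Ind1 w') (Ind1 c').
  case: ext => ex1 ex2 sq tr.
  by split; [exact: ind_hom_exact|exact: ind_hom_exact|exact: ind_hom_square|
    exact: ind_homM].
have [W [v2 [w2 [c2 ext2]]]] :=
  extension_map_exists (Ind1 u') (hull_exact (Ind X')).
have [e ie pd] := ind_shiftP X'.
have [|d iso_d [vd dw]] :=
  mid_compare_iso iext ext2 _ (@traceable_hull _ _ _ (Ind X')) ie pd.
  exact/ind_traceable/traceable_hull.
exists (Ind X'), (Ind Y'), W, (Ind1 u'), v2, w2, (Ind1 a), (Ind1 b).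
exists (comp_hom d (Ind1 c)).
split.
- by apply/standard_triangleP; exists c2.
- split; [exact: ind_stable_iso|exact: ind_stable_iso|].
  exact: stable_iso_comp (ind_stable_iso ic) iso_d.
split; apply/stable_eqP; rewrite !comp_homE.
- rewrite (ind_homM (h := comp_hom b u)) // (ind_homM (h := comp_hom u' a)) //.
  by apply: ind_stably_eq; apply/stable_eqP.
- rewrite mulmxA (ind_homM (h := comp_hom c v)) // -vd mulmxA.
  rewrite (ind_homM (h := comp_hom v' b)) //.
  apply: stably_mul_r; first exact: equiv_hom.
  by apply: ind_stably_eq; apply/stable_eqP.
rewrite -(mulmxA _ d) dw (mulmxA (Ind1 c)) -(mulmxA (Ind1 w)).
apply: (stably_trans (g := Ind1 w *m (Ind1 (shift_hom a) *m ind_shift X'))).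
  by apply: stably_mul_l (ind_shift_nat a); exact: equiv_hom.
rewrite (mulmxA (Ind1 w)); apply: stably_mul_r; first exact: equiv_hom.
rewrite (ind_homM (h := comp_hom (shift_hom a) w)) //.
rewrite (ind_homM (h := comp_hom w' c)) //.
by apply: ind_stably_eq; apply/stable_eqP.
Qed.

Lemma stable_ind_exact : exact_functor (stable_ind k sHG).
Proof.
split.
- by move=> X Y f g /stable_eqP fg; apply/stable_eqP/ind_stably_eq.
- by move=> X; apply: stable_eq_mx; apply: ind_hom_id.
- by move=> X Y Z g f; apply: stable_eq_mx; apply/esym/ind_homM.
- move=> X Y f g; apply: stable_eq_mx.
  change (mx_of_hom (Ind1 (add_hom f g)) = mx_of_hom (Ind1 f) + mx_of_hom (Ind1 g)).
  by rewrite !ind_homE -ind_mapD.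
exists ind_shift; split.
- exact: ind_shift_iso.
- by move=> X Y f; apply/stable_eqP; apply: ind_shift_nat.
- exact: ind_triangle.
Qed.

End ExactInduction.

(** * Tensor products and duals *)

Local Notation "X ⊗ Y" := (tens_module X Y) (at level 40, left associativity).

Section TensorIso.
Variables (k : fieldType) (gT : finGroupType) (G : {group gT}).
Implicit Types A B C D X Y Z : representation k G.
Definition module_iso X Y := exists (f : mod_hom X Y) (g : mod_hom Y X),
  f *m g = 1%:M /\ g *m f = 1%:M.

Lemma module_iso_sym X Y : module_iso X Y -> module_iso Y X.
Proof. by case=> f [g [fg gf]]; exists g, f. Qed.

Lemma module_iso_trans X Y Z : module_iso X Y -> module_iso Y Z -> module_iso X Z.
Proof.
move=> [f [g [fg gf]]] [f' [g' [fg' gf']]].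
exists (comp_hom f' f), (comp_hom g g'); rewrite !comp_homE; split.
  by rewrite -mulmxA (mulmxA (mx_of_hom f')) fg' mul1mx.
by rewrite -mulmxA (mulmxA (mx_of_hom g)) gf mul1mx.
Qed.

Lemma iso_stable_retract X Y : module_iso X Y -> stable_retract X Y.
Proof. by case=> f [g [fg _]]; exists f, g; rewrite fg; apply: stably_refl. Qed.

Lemma thick_iso P X Y : thick_modules P -> module_iso X Y -> P X <-> P Y.
Proof.
move=> tP XY; split; apply: (thick_summand tP); apply: iso_stable_retract => //.
exact: module_iso_sym.
Qed.

(** The coherence isomorphisms of the tensor product permute the basis
vectors. *)
Lemma reindex_iso X Y (s : 'I_(rdegree X) -> 'I_(rdegree Y)) s' :
    cancel s s' -> cancel s' s ->
    (forall x i j, x \in G -> X x i j = Y x (s i) (s j)) ->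
  module_iso X Y.
Proof.
move=> sK s'K XY.
pose f : 'M[k]_(rdegree X, rdegree Y) := \matrix_(i, j) (s i == j)%:R.
pose g : 'M[k]_(rdegree Y, rdegree X) := \matrix_(i, j) (s' i == j)%:R.
have ss' i j : (s i == j) = (i == s' j).
  by apply/eqP/eqP=> [<-|->]; rewrite ?sK ?s'K.
have s's i j : (s' i == j) = (i == s j).
  by apply/eqP/eqP=> [<-|->]; rewrite ?sK ?s'K.
have Mf n (A : 'M_(n, _)) i j : (A *m f) i j = A i (s' j).
  rewrite mxE (bigD1 (s' j)) //= mxE s'K eqxx mulr1 big1 ?addr0 // => l ne.
  by rewrite mxE ss' (negPf ne) mulr0.
have Mg n (A : 'M_(n, _)) i j : (A *m g) i j = A i (s j).
  rewrite mxE (bigD1 (s j)) //= mxE sK eqxx mulr1 big1 ?addr0 // => l ne.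
  by rewrite mxE s's (negPf ne) mulr0.
have fM n (A : 'M_(_, n)) i j : (f *m A) i j = A (s i) j.
  rewrite mxE (bigD1 (s i)) //= mxE eqxx mul1r big1 ?addr0 // => l ne.
  by rewrite mxE eq_sym (negPf ne) mul0r.
have gM n (A : 'M_(_, n)) i j : (g *m A) i j = A (s' i) j.
  rewrite mxE (bigD1 (s' i)) //= mxE eqxx mul1r big1 ?addr0 // => l ne.
  by rewrite mxE eq_sym (negPf ne) mul0r.
have ef : equivariant X Y f.
  by move=> x Gx; apply/matrixP=> i j; rewrite Mf fM XY // s'K.
have eg : equivariant Y X g.
  by move=> x Gx; apply/matrixP=> i j; rewrite Mg gM XY // s'K.
exists (ModHom ef), (ModHom eg); split; apply/matrixP=> i j /=.
  by rewrite Mg !mxE (can_eq sK).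
by rewrite Mf !mxE (can_eq s'K).
Qed.

Local Notation pair := (@mxtens_index _ _).
Local Notation unpair := (@mxtens_unindex _ _).

Lemma tens_comm X Y : module_iso (X ⊗ Y) (Y ⊗ X).
Proof.
pose s (l : 'I_(rdegree (X ⊗ Y))) : 'I_(rdegree (Y ⊗ X)) :=
  pair ((unpair l).2, (unpair l).1).
pose s' (l : 'I_(rdegree (Y ⊗ X))) : 'I_(rdegree (X ⊗ Y)) :=
  pair ((unpair l).2, (unpair l).1).
apply: (@reindex_iso _ _ s s') => [l|l|x l m Gx].
- by rewrite /s /s' mxtens_indexK -surjective_pairing mxtens_unindexK.
- by rewrite /s /s' mxtens_indexK -surjective_pairing mxtens_unindexK.
case: (mxtens_indexP l) => i j; case: (mxtens_indexP m) => i' j'.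
by rewrite /s !mxtens_indexK /= !tensmxE mulrC.
Qed.

Lemma tens_assoc X Y Z : module_iso (X ⊗ (Y ⊗ Z)) (X ⊗ Y ⊗ Z).
Proof.
pose s (l : 'I_(rdegree (X ⊗ (Y ⊗ Z)))) : 'I_(rdegree (X ⊗ Y ⊗ Z)) :=
  let: (i, j) := unpair l in pair (pair (i, (unpair j).1), (unpair j).2).
pose s' (l : 'I_(rdegree (X ⊗ Y ⊗ Z))) : 'I_(rdegree (X ⊗ (Y ⊗ Z))) :=
  let: (i, j) := unpair l in pair ((unpair i).1, pair ((unpair i).2, j)).
apply: (@reindex_iso _ _ s s') => [l|l|x l m Gx].
- case: (mxtens_indexP l) => i j; case: (mxtens_indexP j) => j1 j2.
  by rewrite /s !mxtens_indexK /s' !mxtens_indexK.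
- case: (mxtens_indexP l) => i j; case: (mxtens_indexP i) => i1 i2.
  by rewrite /s' !mxtens_indexK /s !mxtens_indexK.
case: (mxtens_indexP l) => i j; case: (mxtens_indexP j) => j1 j2.
case: (mxtens_indexP m) => i' j'; case: (mxtens_indexP j') => j1' j2'.
by rewrite /s !mxtens_indexK /= !tensmxE mulrA.
Qed.

Lemma tens_unit X : module_iso (triv_module k G ⊗ X) X.
Proof.
pose s (l : 'I_(rdegree (triv_module k G ⊗ X))) : 'I_(rdegree X) := (unpair l).2.
pose s' (i : 'I_(rdegree X)) : 'I_(rdegree (triv_module k G ⊗ X)) :=
  pair (0 : 'I_1, i).
apply: (@reindex_iso _ _ s s') => [l|l|x l m Gx].
- by case: (mxtens_indexP l) => i j; rewrite /s /s' mxtens_indexK ord1.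
- by rewrite /s /s' mxtens_indexK.
case: (mxtens_indexP l) => i j; case: (mxtens_indexP m) => i' j'.
by rewrite /s !mxtens_indexK /= !tensmxE !ord1 mxE eqxx mul1r.
Qed.

Lemma tens_iso X X' Y Y' : module_iso X X' -> module_iso Y Y' ->
  module_iso (X ⊗ Y) (X' ⊗ Y').
Proof.
move=> [f [g [fg gf]]] [f' [g' [fg' gf']]].
have ef : equivariant (X ⊗ Y) (X' ⊗ Y') (f *t f').
  by move=> x Gx; rewrite /= !tensmx_mul !mx_of_homP.
have eg : equivariant (X' ⊗ Y') (X ⊗ Y) (g *t g').
  by move=> x Gx; rewrite /= !tensmx_mul !mx_of_homP.
by exists (ModHom ef), (ModHom eg); rewrite /= !tensmx_mul fg gf fg' gf' !tens1mx1.
Qed.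

Lemma module_iso_refl X : module_iso X X.
Proof. by exists (id_hom X), (id_hom X); rewrite mulmx1. Qed.

Lemma tens_rightC X Y Z : module_iso (X ⊗ Y ⊗ Z) (X ⊗ Z ⊗ Y).
Proof.
apply: module_iso_trans (tens_assoc X Z Y).
apply: module_iso_trans (module_iso_sym (tens_assoc X Y Z)) _.
by apply: tens_iso (module_iso_refl X) _; apply: tens_comm.
Qed.

Lemma tens_medial A B C D : module_iso (A ⊗ B ⊗ (C ⊗ D)) (A ⊗ C ⊗ (B ⊗ D)).
Proof.
apply: module_iso_trans (tens_assoc _ _ _) _.
apply: module_iso_trans (tens_iso (tens_rightC _ _ _) (module_iso_refl _)) _.
exact/module_iso_sym/tens_assoc.
Qed.

End TensorIso.

Section Rigidity.
Variables (k : fieldType) (gT : finGroupType) (G : {group gT}).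
Implicit Types X Y Z : representation k G.
Lemma dual_mx_mul X x : x \in G ->
  forall i j, \sum_l X x i l * dual X x j l = (i == j)%:R.
Proof.
move=> Gx i j; transitivity ((X x *m X x^-1%g) i j).
  by rewrite mxE; apply: eq_bigr => l _; rewrite mxE.
by rewrite -repr_mxM ?groupV // mulgV repr_mx1 mxE.
Qed.

Lemma dual_mx_mulr X x : x \in G ->
  forall i j, \sum_l dual X x l i * X x l j = (i == j)%:R.
Proof.
move=> Gx i j; transitivity ((X x^-1%g *m X x) i j).
  by rewrite mxE; apply: eq_bigr => l _; rewrite mxE.
by rewrite -repr_mxM ?groupV // mulVg repr_mx1 mxE.
Qed.

Definition eval_mx X : 'M[k]_(rdegree (X ⊗ dual X), 1) :=
  \matrix_(i, j) ((mxtens_unindex i).1 == (mxtens_unindex i).2)%:R.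

Lemma sum_tens m n (F : 'I_(m * n) -> k) :
  \sum_l F l = \sum_i \sum_j F (mxtens_index (i, j)).
Proof.
rewrite pair_bigA (reindex (@mxtens_index m n)) /=.
  by apply: eq_bigr => -[].
by exists (@mxtens_unindex m n) => ij _; rewrite (mxtens_indexK, mxtens_unindexK).
Qed.

Lemma sum_delta n (F : 'I_n -> k) i : \sum_j F j * (j == i)%:R = F i.
Proof.
rewrite (bigD1 i) //= eqxx mulr1 big1 ?addr0 // => j /negPf->.
exact: mulr0.
Qed.

Lemma eval_equiv X : equivariant (X ⊗ dual X) (triv_module k G) (eval_mx X).
Proof.
move=> x Gx; rewrite mulmx1; apply/matrixP=> l z; rewrite [LHS]mxE sum_tens.
case: (mxtens_indexP l) => i j; rewrite !mxE mxtens_indexK /= -(dual_mx_mul Gx).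
apply: eq_bigr => i' _.
rewrite -(sum_delta (fun j' => X x i i' * dual X x j j') i').
apply: eq_bigr => j' _.
by rewrite tensmxE [eval_mx _ _ _]mxE mxtens_indexK /= (eq_sym i').
Qed.

Definition coeval_mx X (f : 'M[k]_(rdegree X)) : 'M[k]_(1, rdegree (X ⊗ dual X)) :=
  \matrix_(i, j) f (mxtens_unindex j).2 (mxtens_unindex j).1.

Lemma coeval_equiv X f : equivariant X X f ->
  equivariant (triv_module k G) (X ⊗ dual X) (coeval_mx f).
Proof.
move=> ef x Gx; rewrite mul1mx; apply/matrixP=> z l; rewrite [RHS]mxE sum_tens.
case: (mxtens_indexP l) => i j; rewrite mxE mxtens_indexK /=.
have {1}-> : f = X x^-1%g *m (f *m X x) by rewrite -ef // repr_mulVK.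
rewrite mulmxA mxE; apply: eq_bigr => i' _; rewrite mxE mulr_suml.
apply: eq_bigr => j' _; rewrite tensmxE !mxE mxtens_indexK /=.
by rewrite mulrAC mulrC (mulrC (X x i' i)).
Qed.

Lemma coeval_eval X f : coeval_mx f *m eval_mx X = (\tr f)%:M.
Proof.
apply/matrixP=> z z'; rewrite [LHS]mxE sum_tens !ord1 mxE eqxx mulr1n.
apply: eq_bigr => i _; rewrite -[RHS](sum_delta (fun j => f j i)).
by apply: eq_bigr => j _; rewrite !mxE mxtens_indexK /= (eq_sym i).
Qed.

(** An equivariant [f] gives a map from the unit to the endomorphism module of
X, and its composite with evaluation is the trace of [f]. *)
Lemma trace_retract X f : equivariant X X f -> \tr f != 0 ->
  stable_retract (triv_module k G) (X ⊗ dual X).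
Proof.
move=> ef tr0; exists (ModHom (coeval_equiv ef)).
have ee : equivariant (X ⊗ dual X) (triv_module k G) ((\tr f)^-1 *: eval_mx X).
  by move=> x Gx; rewrite -scalemxAl -scalemxAr eval_equiv.
exists (ModHom ee); rewrite /= -scalemxAr coeval_eval scale_scalar_mx mulVf //.
exact: stably_refl.
Qed.

(** v |-> v (x) (the canonical element of X* (x) X). *)
Definition coeval_tens_mx X :
    'M[k]_(rdegree (triv_module k G ⊗ X), rdegree (X ⊗ dual X ⊗ X)) :=
  \matrix_(i, j) (((mxtens_unindex i).2 ==
      (mxtens_unindex (mxtens_unindex j).1).1)%:R
    * ((mxtens_unindex (mxtens_unindex j).1).2 == (mxtens_unindex j).2)%:R).

Lemma coeval_tens_mxE X z a p q s :
  coeval_tens_mx X (mxtens_index (z, a)) (mxtens_index (mxtens_index (p, q), s))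
    = (a == p)%:R * (q == s)%:R.
Proof. by rewrite mxE !mxtens_indexK. Qed.

Lemma coeval_tens_equiv X :
  equivariant (triv_module k G ⊗ X) (X ⊗ dual X ⊗ X) (coeval_tens_mx X).
Proof.
move=> x Gx; apply/matrixP=> l m.
case: (mxtens_indexP l) => z a; case: (mxtens_indexP m) => pq s.
case: (mxtens_indexP pq) => p q; rewrite [LHS]mxE [RHS]mxE !sum_tens.
rewrite big_ord1.
transitivity (X x a p * (q == s)%:R).
  rewrite -(sum_delta (X x a)) mulr_suml; apply: eq_bigr => b _.
  by rewrite coeval_tens_mxE tensmxE !mxE !ord1 eqxx mul1r mulrA.
rewrite -(sum_delta (fun b => X x b p * (q == s)%:R) a).
apply: eq_bigr => b _.
transitivity (\sum_c \sum_d ((a == b)%:R * (c == d)%:R)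
  * (X x b p * dual X x c q * X x d s)); last first.
  by apply: eq_bigr => c _; apply: eq_bigr => d _; rewrite coeval_tens_mxE !tensmxE.
rewrite -(dual_mx_mulr Gx q s) mulrAC mulr_sumr; apply: eq_bigr => c _.
rewrite -(sum_delta (fun d => X x b p * (b == a)%:R * (dual X x c q * X x d s)) c).
apply: eq_bigr => d _; rewrite (eq_sym a) (eq_sym c).
move: (X x b p) (dual X x c q) (X x d s) => u v w.
ring.
Qed.

Lemma coeval_tens_eval X : coeval_tens_mx X *m (eval_mx X *t 1%:M) = 1%:M.
Proof.
apply/matrixP=> l m; case: (mxtens_indexP l) => z a.
case: (mxtens_indexP m) => z' a'; rewrite [LHS]mxE sum_tens sum_tens.
rewrite [RHS]mxE (inj_eq (can_inj (@mxtens_indexK _ _))) xpair_eqE !ord1 eqxx /=.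
transitivity (\sum_p \sum_q \sum_s ((a == p)%:R * (q == s)%:R)
    * ((p == q)%:R * (s == a')%:R) : k).
  apply: eq_bigr => p _; apply: eq_bigr => q _; apply: eq_bigr => s _.
  by rewrite coeval_tens_mxE tensmxE [eval_mx _ _ _]mxE mxtens_indexK [1%:M _ _]mxE.
rewrite -(sum_delta (fun p => (p == a')%:R) a); apply: eq_bigr => p _.
rewrite -(sum_delta (fun q => (q == a')%:R * (p == a)%:R) p).
apply: eq_bigr => q _.
rewrite -(sum_delta (fun s => (s == a')%:R * (p == a)%:R * (q == p)%:R) q).
apply: eq_bigr => s _; rewrite (eq_sym a p) (eq_sym q s) (eq_sym p q).
ring.
Qed.

(** One of the triangle identities of duality; it makes tensor ideals radical
([ideal_radical]). *)
Lemma rigid_retract X : stable_retract X (X ⊗ dual X ⊗ X).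
Proof.
have [f [g [fg _]]] := module_iso_sym (tens_unit X).
have er : equivariant (X ⊗ dual X ⊗ X) (triv_module k G ⊗ X) (eval_mx X *t 1%:M).
  move=> x Gx; rewrite [LHS]tensmx_mul [RHS]tensmx_mul mulmx1 mul1mx.
  by rewrite eval_equiv.
exists (comp_hom (ModHom (@coeval_tens_equiv X)) f), (comp_hom g (ModHom er)).
rewrite !comp_homE -!mulmxA (mulmxA (coeval_tens_mx X)) coeval_tens_eval mul1mx fg.
exact: stably_refl.
Qed.

End Rigidity.

(** * Exact operations on modules, restriction and Frobenius reciprocity *)

(** What is needed of an operation on modules for the preimage of a thick
subcategory to be thick ([thick_preimage]). *)
Record exact_map (k : fieldType) (gT gT' : finGroupType) (G : {group gT})
    (G' : {group gT'}) (F : representation k G -> representation k G') : Prop := {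
  exact_map_traceable : forall X, traceable X -> traceable (F X);
  exact_map_retract : forall X Y, stable_retract X Y -> stable_retract (F X) (F Y);
  exact_map_seq : forall X Y Z, exact_seq X Y Z -> exact_seq (F X) (F Y) (F Z)
}.

Section ExactMaps.
Variable k : fieldType.

Lemma exact_map_comp (gT gT' gT'' : finGroupType) (G : {group gT})
    (G' : {group gT'}) (G'' : {group gT''})
    (F : representation k G -> representation k G')
    (F' : representation k G' -> representation k G'') :
  exact_map F -> exact_map F' -> exact_map (fun X => F' (F X)).
Proof.
move=> eF eF'; split=> [X tX|X Y rXY|X Y Z eXYZ].
- exact/(exact_map_traceable eF')/(exact_map_traceable eF).
- exact/(exact_map_retract eF')/(exact_map_retract eF).
- exact/(exact_map_seq eF')/(exact_map_seq eF).
Qed.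

Lemma thick_preimage (gT gT' : finGroupType) (G : {group gT}) (G' : {group gT'})
    (F : representation k G -> representation k G') P :
  exact_map F -> thick_modules P -> thick_modules [set X | P (F X)].
Proof.
move=> eF tP; split=> [X tX|X Y rXY|X Y Z eXYZ] /=.
- exact/(thick_traceable tP)/(exact_map_traceable eF).
- exact/(thick_summand tP)/(exact_map_retract eF).
- exact/(thick_exact tP)/(exact_map_seq eF).
Qed.

Variables (gT : finGroupType) (G H : {group gT}).
Hypothesis sHG : H \subset G.

Lemma tens_exact_map (Y : representation k G) : exact_map (fun X => X ⊗ Y).
Proof.
split=> [X tX|X X' [i [r [s ir]]]|X X' X'' [f [g fg]]].
- exact: traceable_tensl.
- have ei : equivariant (X ⊗ Y) (X' ⊗ Y) (i *t 1%:M).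
    by move=> x Gx; rewrite /= !tensmx_mul mx_of_homP // mulmx1 mul1mx.
  have er : equivariant (X' ⊗ Y) (X ⊗ Y) (r *t 1%:M).
    by move=> x Gx; rewrite /= !tensmx_mul mx_of_homP // mulmx1 mul1mx.
  exists (ModHom ei), (ModHom er), (s *t 1%:M).
  rewrite /= tensmx_mul mulmx1 -tens1mx1; apply/eqP; rewrite subr_eq; apply/eqP.
  transitivity ((transfer X X s + 1%:M) *t (1%:M : 'M_(rdegree Y))).
    by rewrite -ir subrK.
  rewrite tensmxDl tensmx_suml; congr (_ + _); apply: eq_bigr => x Gx.
  by rewrite /= !tensmx_mul mulmx1 -repr_mxM ?groupV // mulVg repr_mx1.
have ef : equivariant (X ⊗ Y) (X' ⊗ Y) (f *t 1%:M).
  by move=> x Gx; rewrite /= !tensmx_mul mx_of_homP // mulmx1 mul1mx.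
have eg : equivariant (X' ⊗ Y) (X'' ⊗ Y) (g *t 1%:M).
  by move=> x Gx; rewrite /= !tensmx_mul mx_of_homP // mulmx1 mul1mx.
exists (ModHom ef), (ModHom eg); exact: split_exact_tensl.
Qed.

Definition res (M : representation k G) : representation k H :=
  Representation (subg_repr M sHG).

Lemma rcosets_sum_split (V : nmodType) (F : gT -> V) :
  \sum_(x in G) F x = \sum_(h in H) \sum_(C in rcosets H G) F (h * repr C)%g.
Proof.
rewrite exchange_big /=.
rewrite (partition_big (fun x => H :* x)%g (mem (rcosets H G))) /=; last first.
  by move=> x Gx; apply/rcosetsP; exists x.
apply: eq_bigr => C CG; have [GC CE] := mem_rcosets_repr sHG CG.
rewrite (reindex_onto (fun h => h * repr C)%g (fun x => x * (repr C)^-1)%g) /=.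
  apply: eq_bigl => h; rewrite mulgK eqxx andbT.
  apply/andP/idP=> [[Ghr /eqP E]|Hh].
    by rewrite -(mulgK (repr C) h) (rcosets_reprE sHG Ghr CG) E eqxx.
  have Ghr : (h * repr C)%g \in G by rewrite groupM // (fintype.subsetP sHG).
  by rewrite eq_sym -(rcosets_reprE sHG Ghr CG) mulgK.
by move=> x _; rewrite mulgKV.
Qed.

(** The sum over G is the sum over H of a sum over coset representatives. *)
Lemma transfer_res (M N : representation k G) s :
  exists s', transfer M N s = transfer (res M) (res N) s'.
Proof.
exists (\sum_(C in rcosets H G) M (repr C) *m s *m N (repr C)^-1%g).
rewrite {1}/transfer (reindex_inj invg_inj) /=.
rewrite (eq_bigl (mem G)) => [|x]; last by rewrite /= groupV.
rewrite rcosets_sum_split (reindex_inj invg_inj) /=.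
apply: eq_big => [h|h Hh]; first by rewrite groupV.
have Gh : h \in G by rewrite -groupV (fintype.subsetP sHG).
rewrite mulmx_sumr mulmx_suml; apply: eq_bigr => C /(mem_rcosets_repr sHG)[GC _].
by rewrite invgK invMg invgK !repr_mxM ?groupV // !mulmxA.
Qed.

Definition res_hom (M N : representation k G) (f : mod_hom M N) :
    mod_hom (res M) (res N) :=
  @ModHom _ _ _ (res M) (res N) f
    (fun x Hx => mx_of_homP f (fintype.subsetP sHG x Hx)).

Lemma res_exact_map : exact_map res.
Proof.
split=> [X [s s1]|X Y [i [r [s ir]]]|X Y Z [f [g fg]]].
- by have [s' E] := transfer_res s; exists s'; rewrite -E.
- have [s' E] := transfer_res s.
  by exists (res_hom i), (res_hom r), s'; rewrite -E -ir.
- by exists (res_hom f), (res_hom g).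
Qed.

Lemma ind_exact_map : exact_map (ind (k := k) sHG).
Proof.
split=> [X|X Y [i [r ir]]|X Y Z [f [g fg]]].
- exact: ind_traceable.
- exists (ind_hom sHG i), (ind_hom sHG r); rewrite -(ind_hom_id sHG).
  rewrite (@ind_homM _ _ _ _ sHG _ _ _ i r (comp_hom r i)) //.
  exact: (ind_stably_eq sHG (f := comp_hom r i) (g := id_hom X)).
- by exists (ind_hom sHG f), (ind_hom sHG g); apply: ind_hom_exact.
Qed.

Implicit Types (M N : representation k H) (V W : representation k G).

Lemma induced_iso M V W :
  induced_data M V -> induced_data M W -> module_iso V W.
Proof.
move=> DV DW.
have eq1 h : h \in H -> M h *m 1%:M = 1%:M *m M h by rewrite mulmx1 mul1mx.
exists (ModHom (ind_map_equiv sHG DV DW eq1)).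
exists (ModHom (ind_map_equiv sHG DW DV eq1)).
by rewrite /= !(ind_mapM sHG) mulmx1 !ind_map1.
Qed.

Lemma tens_induced M V W : induced_data M V ->
  induced_data (M ⊗ res W) (V ⊗ W).
Proof.
case=> [i o iP oP io oi].
apply: (@InducedData _ _ _ _ (M ⊗ res W) (V ⊗ W) (i *t 1%:M) (o *t 1%:M)).
- by move=> h Hh; rewrite /= !tensmx_mul mulmx1 mul1mx iP.
- by move=> h Hh; rewrite /= !tensmx_mul mulmx1 mul1mx oP.
- move=> x Gx; rewrite /= !tensmx_mul mulmx1 mul1mx io //.
  by case: ifP => //; rewrite tens0mx.
rewrite -tens1mx1 -oi tensmx_suml; apply: eq_bigr => C /(mem_rcosets_repr sHG)[GC _].
rewrite /= !tensmx_mul !mulmx1 -repr_mxM ?groupV //.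
by rewrite mulVg repr_mx1.
Qed.

(** Both sides are induced from [M ⊗ res W]: tensor the system of imprimitivity
of [ind sHG M] with W. *)
Lemma frobenius M W : module_iso (ind sHG (M ⊗ res W)) (ind sHG M ⊗ W).
Proof.
by apply: induced_iso (tens_induced W (ind_data sHG M)); apply: ind_data.
Qed.

Lemma res_ind_retract M : stable_retract M (res (ind sHG M)).
Proof.
pose D := ind_data sHG M.
exists (@ModHom _ _ _ M (res (ind sHG M)) _ (ind_inP D)).
exists (@ModHom _ _ _ (res (ind sHG M)) M _ (ind_outP D)).
have := ind_in_out D (group1 G); rewrite group1 !repr_mx1 mulmx1 => E.
by rewrite /= E; apply: stably_refl.
Qed.

Lemma res_unit_iso : module_iso (res (triv_module k G)) (triv_module k H).
Proof. exact: (@reindex_iso _ _ _ (res (triv_module k G)) (triv_module k H) id id). Qed.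

Lemma res_tens_iso V W : module_iso (res (V ⊗ W)) (res V ⊗ res W).
Proof. exact: (@reindex_iso _ _ _ (res (V ⊗ W)) (res V ⊗ res W) id id). Qed.

Lemma thick_ind_iso P M N : thick_modules P -> module_iso M N ->
  P (ind sHG M) <-> P (ind sHG N).
Proof.
by move=> tP MN; apply: (thick_iso (thick_preimage ind_exact_map tP) MN).
Qed.

End ExactMaps.

(** * The topology of the spectrum *)

Section Irreducible.
Variable T : topologicalType.
Implicit Types (Z U V : set T) (x : T).

Lemma irreducible_meetI Z U V : irreducible_closed Z -> open U -> open V ->
  Z `&` U !=set0 -> Z `&` V !=set0 -> Z `&` (U `&` V) !=set0.
Proof.
move=> [_ _ irrZ] oU oV [x [Zx Ux]] [y [Zy Vy]].
apply: contrapT => nZUV.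
have [||z Zz|ZU|ZV] := irrZ (~` U) (~` V).
- exact: open_closedC.
- exact: open_closedC.
- have [Uz|] := pselect (U z); last by left.
  by have [Vz|] := pselect (V z); [case: nZUV; exists z|right].
- exact: ZU Ux.
- exact: ZV Vy.
Qed.

(** The opens that meet an irreducible closed set have the finite intersection
property on it. *)
Lemma irreducible_meet Z (s : seq (set T)) : irreducible_closed Z ->
    (forall U, U \in s -> open U /\ Z `&` U !=set0) ->
  exists2 z, Z z & forall U, U \in s -> U z.
Proof.
move=> irrZ sZ.
suff [_ [z [Zz sz]]] : open (foldr setI setT s) /\ Z `&` foldr setI setT s !=set0.
  exists z => // U; elim: s sz {sZ} => //= V s IHs [Vz sz].
  by rewrite inE => /orP[/eqP->//|/IHs]; apply.
elim: s sZ => [|U s IHs] sZ /=.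
  by split; [exact: openT|case: irrZ => _ [z Zz] _; exists z].
have [oU ZU] := sZ U (mem_head _ _).
have [|os Zs] := IHs; first by move=> V Vs; apply: sZ; rewrite inE Vs orbT.
by split; [exact: openI|exact: irreducible_meetI].
Qed.

Lemma irreducible_closure x : irreducible_closed (closure [set x]).
Proof.
split; [exact: closed_closure|by exists x; apply: subset_closure|].
move=> A B cA cB AB; have [Ax|Bx] := AB x (subset_closure (erefl x)).
  by left; rewrite (closure_id A).1 //; apply: closure_subset => _ ->.
by right; rewrite (closure_id B).1 //; apply: closure_subset => _ ->.
Qed.

End Irreducible.

Section Spectrum.
Variable K : tt_data.
Implicit Types (P Q : Spc K) (O Z : set (Spc K)).

Lemma spc_eq P Q : (forall A, prime_set P A <-> prime_set Q A) -> P = Q.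
Proof.
case: P Q => [P hP] [Q hQ] /= PQ.
have E : P = Q by apply/funext=> A; apply/propext.
by rewrite E in hP *; congr PrimeIdeal; apply: Prop_irrelevance.
Qed.

Lemma open_spc_nbhs O P : open O -> O P ->
  exists2 s : seq (set (Spc K)), forall U, U \in s -> U P /\ exists A, ~` supp A = U
    & forall Q, (forall U, U \in s -> U Q) -> O Q.
Proof.
case=> D sD <- [U DU UP]; have [F sF UE] := sD U DU; exists F.
  move=> V FV; split; first by move: UP; rewrite -UE; apply.
  by have := sF V FV; rewrite inE => -[A _ <-]; exists A.
by move=> Q FQ; exists U => //; change (U Q); rewrite -UE => V; apply: FQ.
Qed.

Lemma open_nsupp (A : K) : open (~` supp A).
Proof.
exists [set ~` supp A]; last by rewrite bigcup_set1.
move=> _ ->; exists [fset (~` supp A)]%fset.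
  by move=> V; rewrite in_fset1 => /eqP VE; apply/mem_set; exists A => //; rewrite -VE.
by rewrite set_fset1 bigcap_set1.
Qed.

Lemma open_nsuppE (A : K) P : (~` supp A) P <-> prime_set P A.
Proof. by split=> [/contrapT//|PA nPA]. Qed.

(** Open sets are upward closed, as the subbasic ones are; conversely the
complement of the points below [P] is a union of subbasic ones. *)
Lemma closure_point P Q : closure [set P] Q <-> forall A, prime_set Q A -> prime_set P A.
Proof.
split=> [clPQ A QA|QP].
  have [|R [-> /open_nsuppE//]] := clPQ (~` supp A).
  by apply: open_nbhs_nbhs; split; [exact: open_nsupp|apply/open_nsuppE].
move=> B; rewrite nbhsE => -[O [oO OQ] OB]; exists P; split=> //; apply: OB.
have [s sQ sO] := open_spc_nbhs oO OQ; apply: sO => U /sQ[UQ [A UE]].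
by rewrite -UE in UQ *; apply/open_nsuppE/QP/open_nsuppE.
Qed.

End Spectrum.

(** * Krull dimension *)

Section KrullDimension.

(** If A has an integral upper bound m, the least upper bound is m - n for the
largest n such that m - n is still an upper bound, or -oo if there is no largest
such n. *)
Lemma supremums_int (A : set (\bar int)) : supremums A !=set0.
Proof.
have [[m Am]|noub] := pselect (exists m : int, ubound A m%:E); last first.
  exists +oo%E; split=> [a _|y yA]; first exact: leey.
  case: y yA => [m||] yA //; first by case: noub; exists m.
  by case: noub; exists 0 => a /yA; rewrite leeNy_eq => /eqP->.
have [allub|/existsNP[n0 n0P]] := pselect (forall n : nat, ubound A (m - n%:Z)%:E).
  exists -oo%E; split=> [a Aa|y _]; last exact: leNye.
  case: a Aa => [r||] // Aa; last by have := Am _ Aa.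
  by have := allub (absz (m - r + 1)) _ Aa; rewrite lee_fin; lia.
have ex : exists n, ~~ `[< ubound A (m - n%:Z)%:E >] by exists n0; apply/asboolPn.
have [n /asboolPn nP minn] := ex_minnP ex.
case: n nP minn => [|n] nP minn; first by case: nP; rewrite subr0.
exists (m - n%:Z)%:E; split=> [|y yA].
  apply: contrapT => nub; have : (n.+1 <= n)%N by apply/minn/asboolPn.
  by rewrite ltnn.
have [a Aa lt_a] : exists2 a, A a & ~~ (a <= (m - n.+1%:Z)%:E)%E.
  apply: contrapT => h; apply: nP => a Aa.
  by apply: contrapT => na; apply: h; exists a => //; apply/negP.
apply: le_trans (yA _ Aa); rewrite -ltNge in lt_a.
case: a {Aa} lt_a => [r||]; rewrite ?leey ?ltNge ?leNye //.
by rewrite -ltNge lte_fin lee_fin; lia.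
Qed.

Lemma supremum_int_le (A : set (\bar int)) (y : \bar int) :
  (supremum -oo%E A <= y)%E <-> forall a, A a -> (a <= y)%E.
Proof.
split=> [Ay a Aa|Ay].
  by apply: le_trans Ay; apply: ge_supremum_Nmem => //; apply: supremums_int.
rewrite /supremum; case: ifP => _; first exact: leNye.
by case: xgetP => [x _ [_ xmin]|_]; [exact: xmin|exact: leNye].
Qed.

Lemma krull_dim_le (T : topologicalType) (x : T) (l : int) :
  (krull_dim x <= l%:E)%E <-> forall n, closed_chain x n -> n%:Z <= l.
Proof.
split=> [/supremum_int_le xl n xn|xl].
  by have := xl n%:Z%:E; rewrite lee_fin; apply; exists n.
by apply/supremum_int_le => _ [n xn <-]; rewrite lee_fin xl.
Qed.

Lemma set_dim_le (T : topologicalType) (V : set T) (l : int) :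
  (set_dim V <= l%:E)%E <->
  forall x n, V x -> closed_chain x n -> n%:Z <= l.
Proof.
split=> [/supremum_int_le Vl x n Vx|Vl].
  by apply/krull_dim_le: n; apply: Vl; exists x.
by apply/supremum_int_le => _ [x Vx <-]; apply/krull_dim_le => n; apply: Vl.
Qed.

Lemma closed_chain0 (T : topologicalType) (x : T) : closed_chain x 0.
Proof.
by exists (fun _ => closure [set x]); split=> // i _; apply: irreducible_closure.
Qed.

(** If specializations of [phi x] lift to specializations of [x], a chain ending
at the closure of [phi x] lifts from the top down, once its terms have generic
points. *)
Lemma going_up_chain (S T : topologicalType) (phi : S -> T) :
    (forall Z : set T, irreducible_closed Z -> exists x, Z = closure [set x]) ->
    (forall x y : S, closure [set x] = closure [set y] -> x = y) ->
    (forall x y, closure [set phi x] y -> exists2 z, closure [set x] z & phi z = y) ->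
  forall n x, closed_chain (phi x) n -> closed_chain x n.
Proof.
move=> sober t0 up; elim=> [|n IHn] x [C [irrC ltC Cn]]; first exact: closed_chain0.
have [y CnE] := sober _ (irrC n (leqnSn n)).
have yx : closure [set phi x] y.
  by rewrite -Cn; apply: (properW (ltC n _)) => //; rewrite CnE; apply: subset_closure.
have [z xz zy] := up x y yx.
have [|D [irrD ltD Dn]] := IHn z.
  exists C; split=> [i in_|i in_|]; [exact/irrC/leqW|exact/ltC/leqW|].
  by rewrite zy.
exists (fun i => if (i <= n)%N then D i else closure [set x]).
split=> [i _|i|]; last by rewrite ltnn.
  by case: ifP => [/irrD//|_]; apply: irreducible_closure.
rewrite leq_eqVlt => /orP[/eqP[->]|ltin]; last first.
  by rewrite -ltnS ltnW // -ltnS ltin; apply: ltD.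
rewrite leqnn ltnn Dn; have zx : closure [set z] `<=` closure [set x].
  rewrite [X in _ `<=` X](closure_id _).1; last exact: closed_closure.
  by apply: closure_subset => _ ->.
split=> // clxz; have zxE : z = x by apply: t0; apply/seteqP; split.
by have [_] := ltC n (leqnn _); rewrite CnE Cn -zy zxE; apply.
Qed.

End KrullDimension.

(** * Tensor ideals and prime ideals of modules *)

Section Ideals.
Variables (k : fieldType) (gT : finGroupType) (G : {group gT}).
Local Notation module := (representation k G).
Local Notation unit := (triv_module k G).
Implicit Types (X Y Z : module) (P J : set module).

Record tensor_ideal J : Prop := {
  ideal_thick : thick_modules J;
  ideal_tensor : forall X Y, J Y -> J (X ⊗ Y)
}.

Record prime_modules P : Prop := {
  prime_tensor_ideal :> tensor_ideal P;
  prime_unit : ~ P unit;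
  prime_split : forall X Y, P (X ⊗ Y) -> P X \/ P Y
}.

Lemma ideal_tensorr J X Y : tensor_ideal J -> J X -> J (X ⊗ Y).
Proof.
move=> iJ JX; apply/(thick_iso (ideal_thick iJ) (tens_comm X Y)).
exact: ideal_tensor.
Qed.

Lemma ideal_unit J X : tensor_ideal J -> J unit -> J X.
Proof.
move=> iJ Ju; apply/(thick_iso (ideal_thick iJ) (tens_unit X)).
exact: ideal_tensorr.
Qed.

Lemma prime_modulesP (P : set (stable_category k G)) :
  prime_ideal P <-> prime_modules P.
Proof.
split=> [pP|pP].
  have tP : thick_modules P by apply/thick_modulesP/(prime_thick pP).
  have iP : tensor_ideal P by split=> //; exact: (prime_tensor pP).
  split=> // [Pu|]; last exact: (prime_prime pP).
  by move/eqP: (prime_proper pP); apply; apply/seteqP; split=> // X _; apply: ideal_unit.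
split.
- exact/thick_modulesP/(ideal_thick pP).
- by apply/eqP => PT; apply: (prime_unit pP); rewrite PT.
- exact: (ideal_tensor pP).
- exact: (prime_split pP).
Qed.

(** Colon ideals serve to handle the ideal generated by J and an object without
constructing it (see [prime_exists]). *)
Lemma colon_ideal J Y : tensor_ideal J -> tensor_ideal [set X | J (X ⊗ Y)].
Proof.
move=> iJ; split; first exact: thick_preimage (tens_exact_map Y) (ideal_thick iJ).
move=> X Z /= JZY; apply/(thick_iso (ideal_thick iJ) (tens_assoc X Z Y)).
exact: ideal_tensor.
Qed.

(** The zero ideal of the stable category. *)
Lemma traceable_ideal : tensor_ideal [set X : module | traceable X].
Proof.
split; last by move=> X Y /=; apply: traceable_tensr.
split=> //= [X Y [i [r ir]] tY|X Y Z [f [g fg]]].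
- have : stably_eq X X 0 1%:M.
    apply: stably_trans ir; apply: stably_sym.
    apply: (factor_stably_eq tY (equiv_hom i) (equiv_hom r)).
    by rewrite subr0.
  by case=> s; rewrite sub0r => E; exists (- s); rewrite transferN -E opprK.
have [s [t [fs tg fg0 stE]]] := fg.
have retr (A B : module) (a : mod_hom A B) (b : mod_hom B A) :
    a *m b = 1%:M -> traceable B -> traceable A.
  by move=> ab; apply: traceable_retract (equiv_hom a) (equiv_hom b) ab.
split.
- move=> tX tY; have [r rg _] := traceable_quotient_iso fg tX.
  exact: retr rg tY.
- move=> tY tZ.
  have [h eh hg] := traceable_projective tZ (equiv_hom g) (@equiv1 _ _ _ Z) tg.
  pose q := ModHom (equiv_subhom (id_hom Y) (comp_hom (ModHom eh) g)).
  have q0 : q *m g = 0.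
    by rewrite /= mulmxBl mul1mx -mulmxA hg mulmx1 subrr.
  have qE : q *m s *m f = q.
    by rewrite -[RHS]mulmx1 -stE mulmxDr (mulmxA q g) q0 mul0mx addr0 mulmxA.
  have eqs : equivariant Y X (q *m s).
    by apply: (mono_equiv fs); rewrite qE; apply: equiv_hom.
  have tX : f *m ModHom eqs = 1%:M; last exact: (retr _ _ f (ModHom eqs) tX tY).
  by rewrite /= mulmxBl mul1mx mulmxBr fs !mulmxA fg0 !mul0mx subr0.
- move=> [a a1] [b b1]; have [r fr] := injective_ext (id_hom X) fg (ex_intro _ a a1).
  pose q := ModHom (equiv_subhom (id_hom Y) (comp_hom f r)).
  have [|h gh] := split_exact_factor (h := q) fg.
    by rewrite /= mulmxBr mulmx1 mulmxA fr mul1mx subrr.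
  exists (r *m a *m f + g *m b *m h); rewrite transferD.
  rewrite -(transferMr _ (equiv_hom f)) -(transferMl _ (equiv_hom r)) a1 mulmx1.
  rewrite -(transferMr _ (equiv_hom h)) -(transferMl _ (equiv_hom g)) b1 mulmx1.
  by rewrite gh /= addrC subrK.
Qed.

(** Krull's argument: an ideal Q that is maximal among those that contain J and
avoid S is prime.  For if Q contains X ⊗ Y but neither factor, then the colon
ideal of Q by Y is larger than Q, so it contains some s of S; then the colon
ideal of Q by s contains Y, so it contains some t of S; and t ⊗ s lies in Q. *)
Lemma prime_exists J (S : set module) : tensor_ideal J -> S !=set0 ->
    (forall s, S s -> ~ J s) ->
    (forall s t, S s -> S t -> exists2 u, S u & module_iso u (s ⊗ t)) ->
  exists Q, [/\ prime_modules Q, J `<=` Q & forall s, S s -> ~ Q s].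
Proof.
move=> iJ [s0 Ss0] SJ SM.
(* the empty chain is bounded too, since the candidates are the J `|` A *)
pose avoids A := tensor_ideal (J `|` A) /\ forall s, S s -> ~ (J `|` A) s.
have [F Fav Ftot|A [[iA SA] maxA]] := @Zorn_bigcup module avoids.
  have cover2 X Y : (J `|` \bigcup_(A in F) A) X -> (J `|` \bigcup_(A in F) A) Y ->
      exists A, [/\ avoids A, J `|` A `<=` J `|` \bigcup_(A in F) A,
        (J `|` A) X & (J `|` A) Y].
    have av0 : avoids set0 by rewrite /avoids setU0.
    have subF A : F A -> J `|` A `<=` J `|` \bigcup_(A in F) A.
      by move=> FA Z [JZ|AZ]; [left|right; exists A].
    move=> [JX|[A FA AX]] [JY|[B FB BY]].
    - by exists set0; split=> //; [rewrite setU0; exact: subsetUl|left|left].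
    - by exists B; split; [exact: Fav|exact: subF|left|right].
    - by exists A; split; [exact: Fav|exact: subF|right|left].
    - have [AB|BA] := Ftot A B FA FB.
        by exists B; split; [exact: Fav|exact: subF|right; exact: AB|right].
      by exists A; split; [exact: Fav|exact: subF|right|right; exact: BA].
  split; last first.
    by move=> s Ss Js; have [A [[_ SA] _ As _]] := cover2 s s Js Js; apply: SA As.
  split; last first.
    move=> X Y JY; have [A [[iA _] sA AY _]] := cover2 Y Y JY JY.
    exact/sA/(ideal_tensor iA).
  split.
  - by move=> X tX; left; apply: (thick_traceable (ideal_thick iJ)).
  - move=> X Y XY JY; have [A [[iA _] sA AY _]] := cover2 Y Y JY JY.
    exact/sA/(thick_summand (ideal_thick iA) XY).
  move=> X Y Z XYZ; split=> JX JY;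
    have [A [[[tA _] _] sA AX AY]] := cover2 _ _ JX JY;
    by have [h1 h2 h3] := thick_exact tA XYZ; apply: sA; auto.
have grow I X : tensor_ideal I -> J `|` A `<=` I -> I X -> ~ (J `|` A) X ->
    exists2 s, S s & I s.
  move=> iI AI IX nAX; apply: contrapT => nS.
  have JI : J `|` I = I by apply/setUidPr => Z JZ; apply: AI; left.
  apply: (maxA I); last first.
    by split; rewrite JI // => s Ss Is; apply: nS; exists s.
  split; first by move=> Z AZ; apply: AI; right.
  by move=> IA; apply: nAX; right; apply: IA.
exists (J `|` A); split; [|exact: subsetUl|exact: SA].
split=> // [Au|X Y AXY].
  by apply: (SA s0 Ss0); apply: ideal_unit.
apply: contrapT => /not_orP[nX nY].
have [s Ss sY] : exists2 s, S s & (J `|` A) (s ⊗ Y).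
  apply: (grow _ X (colon_ideal Y iA)) => // Z AZ.
  exact: ideal_tensorr.
have [t St st] : exists2 t, S t & (J `|` A) (t ⊗ s).
  apply: (grow _ Y (colon_ideal s iA)) => // [Z AZ|].
    exact: ideal_tensorr.
  exact/(thick_iso (ideal_thick iA) (tens_comm Y s)).
have [u Su ust] := SM t s St Ss.
by apply: (SA u Su); apply/(thick_iso (ideal_thick iA) ust).
Qed.

Lemma ideal_radical J X : tensor_ideal J -> J (X ⊗ X) -> J X.
Proof.
move=> iJ JX; apply: (thick_summand (ideal_thick iJ) (rigid_retract X)).
apply/(thick_iso (ideal_thick iJ) (tens_rightC X (dual X) X)).
exact: ideal_tensorr.
Qed.

End Ideals.

(** * The map of spectra induced by restriction *)

Section GenericPoints.
Variables (k : fieldType) (gT : finGroupType) (G : {group gT}).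
Local Notation spc := (Spc (stable_category k G)).

Lemma prime_modules_of (P : spc) : prime_modules (prime_set P).
Proof. exact/prime_modulesP/prime_setP. Qed.

(** The generic point of Z consists of the objects contained in some point of Z;
irreducibility makes this a prime ideal. *)
Lemma spc_sober (Z : set spc) : irreducible_closed Z ->
  exists P, Z = closure [set P].
Proof.
move=> irrZ; have [clZ [R0 ZR0] _] := irrZ.
pose PZ := [set A : stable_category k G | exists2 R, Z R & prime_set R A].
have meet A B : PZ A -> PZ B ->
    exists R, [/\ Z R, prime_set R A & prime_set R B].
  move=> [R ZR RA] [R' ZR' RB].
  have [||||S [ZS [/open_nsuppE SA /open_nsuppE SB]]] :=
    @irreducible_meetI _ Z (~` supp A) (~` supp B) irrZ; last by exists S.
  - exact: open_nsupp.
  - exact: open_nsupp.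
  - by exists R; split=> //; apply/open_nsuppE.
  - by exists R'; split=> //; apply/open_nsuppE.
have pPZ : prime_modules PZ.
  split; [split; [split|]| |].
  - move=> X tX; exists R0 => //.
    exact: (thick_traceable (ideal_thick (prime_modules_of R0))).
  - move=> X Y XY [R ZR RY]; exists R => //.
    exact: (thick_summand (ideal_thick (prime_modules_of R)) XY).
  - move=> X Y Z' XYZ; split=> PX PY; have [R [ZR RX RY]] := meet _ _ PX PY;
      have [h1 h2 h3] := thick_exact (ideal_thick (prime_modules_of R)) XYZ;
      by exists R; auto.
  - move=> X Y [R ZR RY]; exists R => //.
    exact: (ideal_tensor (prime_modules_of R)).
  - by case=> R _; apply: (prime_unit (prime_modules_of R)).
  - move=> X Y [R ZR RXY].
    by have [RX|RY] := prime_split (prime_modules_of R) RXY; [left|right]; exists R.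
exists (PrimeIdeal (proj2 (prime_modulesP PZ) pPZ)).
apply/seteqP; split=> Q.
  by move=> ZQ; apply/closure_point => A QA; exists Q.
move=> /closure_point QP; rewrite (closure_id Z).1 //.
move=> B; rewrite nbhsE => -[O [oO OQ] OB].
have [s sQ sO] := open_spc_nbhs oO OQ.
have [|R ZR sR] := irreducible_meet (s := s) irrZ.
  move=> U /sQ[UQ [A UE]]; rewrite -UE in UQ *; split; first exact: open_nsupp.
  have [R ZR RA] : PZ A by apply/QP/open_nsuppE.
  by exists R; split=> //; apply/open_nsuppE.
by exists R; split=> //; apply/OB/sO.
Qed.

Lemma spc_t0 (P Q : spc) : closure [set P] = closure [set Q] -> P = Q.
Proof.
move=> PQ; apply: spc_eq => A; split.
  have /closure_point : closure [set Q] P by rewrite -PQ; apply: subset_closure.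
  exact.
have /closure_point : closure [set P] Q by rewrite PQ; apply: subset_closure.
exact.
Qed.

Lemma dim_leP (l : int) (A : stable_category k G) :
  dim_le l A <-> forall (P : spc) n, ~ prime_set P A -> closed_chain P n -> n%:Z <= l.
Proof. exact: set_dim_le. Qed.

End GenericPoints.

Section Lifting.
Variables (k : fieldType) (gT : finGroupType) (G H : {group gT}).
Hypothesis sHG : H \subset G.
Local Notation Ind := (ind (k := k) sHG).
Local Notation Res := (res sHG).
Implicit Types (P : set (representation k G)) (X Y Z : representation k H).

(** The kernel of induction modulo P.  A prime ideal lies over P only if it
contains the restrictions of the objects of P; this ideal contains them
([ind_ideal_res]) and is in turn contained in every prime ideal over P. *)
Definition ind_ideal P := [set X | forall Y, P (Ind (X ⊗ Y))].

Lemma ind_ideal_tensor P : tensor_ideal P -> tensor_ideal (ind_ideal P).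
Proof.
move=> iP; have tY Y : thick_modules [set X | P (Ind (X ⊗ Y))].
  apply: thick_preimage (ideal_thick iP).
  exact: exact_map_comp (tens_exact_map Y) (ind_exact_map k sHG).
split; [split|].
- by move=> X tX Y; apply: (thick_traceable (tY Y)).
- by move=> X X' XX' PX' Y; apply: (thick_summand (tY Y) XX'); apply: PX'.
- move=> X X' X'' ex; split=> h h' Y; have [h1 h2 h3] := thick_exact (tY Y) ex.
  + exact: h1 (h Y) (h' Y).
  + exact: h2 (h Y) (h' Y).
  + exact: h3 (h Y) (h' Y).
move=> X Z PZ Y.
have iso : module_iso (Z ⊗ (X ⊗ Y)) (X ⊗ Z ⊗ Y).
  apply: module_iso_trans (tens_assoc Z X Y) _.
  exact: tens_iso (tens_comm Z X) (module_iso_refl Y).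
exact/(thick_ind_iso sHG (ideal_thick iP) iso).
Qed.

Lemma ind_ideal_res P B : tensor_ideal P -> P B -> ind_ideal P (Res B).
Proof.
move=> iP PB Y.
apply/(thick_ind_iso sHG (ideal_thick iP) (tens_comm (Res B) Y)).
by apply/(thick_iso (ideal_thick iP) (frobenius sHG Y B))/(ideal_tensor iP).
Qed.

(** By Frobenius reciprocity the induced module of [Y ⊗ Res B ⊗ W] is
[Ind (Y ⊗ W) ⊗ B], and P is prime. *)
Lemma ind_ideal_colon P Y B : prime_modules P -> ~ P B ->
  ind_ideal P (Y ⊗ Res B) -> ind_ideal P Y.
Proof.
move=> pP nPB PYB W; have tP := ideal_thick pP; have := PYB W.
move/(thick_ind_iso sHG tP (tens_rightC Y (Res B) W)).
by move/(thick_iso tP (frobenius sHG (Y ⊗ W) B))/(prime_split pP); case.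
Qed.

Lemma res_prime (Q : set (representation k H)) :
  prime_modules Q -> prime_modules [set X | Q (Res X)].
Proof.
move=> pQ; have tQ := ideal_thick pQ; split; first split.
- exact: thick_preimage (res_exact_map k sHG) tQ.
- move=> X Y QY; apply/(thick_iso tQ (res_tens_iso sHG X Y)).
  exact: ideal_tensor pQ _ _ QY.
- by move/(thick_iso tQ (res_unit_iso k sHG)); apply: prime_unit pQ.
move=> X Y /(thick_iso tQ (res_tens_iso sHG X Y)).
exact: prime_split.
Qed.

(** A prime ideal lies over P as soon as it contains [ind_ideal P] and avoids
the restrictions of the objects outside P.  By [ind_ideal_colon], the products of
these restrictions with elements of T avoid [ind_ideal P]. *)
Lemma prime_lift P (T : set (representation k H)) : prime_modules P ->
    T (triv_module k H) -> (forall X Y, T X -> T Y -> T (X ⊗ Y)) ->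
    (forall X, T X -> ~ ind_ideal P X) ->
  exists Q, [/\ prime_modules Q, forall W, Q (Res W) <-> P W &
    forall X, T X -> ~ Q X].
Proof.
move=> pP T1 TM TP.
pose S := [set Z | exists Y B, [/\ T Y, ~ P B & Z = Y ⊗ Res B]].
have nP1 := prime_unit pP.
have [||||Q [pQ PQ SQ]] := @prime_exists _ _ _ (ind_ideal P) S.
- exact: ind_ideal_tensor pP.
- exists (triv_module k H ⊗ Res (triv_module k G)).
  by exists (triv_module k H), (triv_module k G).
- move=> _ [Y [B [TY nPB ->]]] /ind_ideal_colon PY.
  by apply: (TP Y TY); apply: PY.
- move=> _ _ [Y [B [TY nPB ->]]] [Y' [B' [TY' nPB' ->]]].
  exists ((Y ⊗ Y') ⊗ Res (B ⊗ B')).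
    exists (Y ⊗ Y'), (B ⊗ B'); split=> //; first exact: TM.
    by case/(prime_split pP).
  apply: module_iso_trans (tens_medial Y Y' (Res B) (Res B')).
  exact: tens_iso (module_iso_refl _) (res_tens_iso sHG B B').
have tQ := ideal_thick pQ.
exists Q; split=> // [X|X TX QX].
  split=> [QX|PX]; last exact: PQ (ind_ideal_res pP PX).
  apply: contrapT => nPX; apply: (SQ (triv_module k H ⊗ Res X)).
    by exists (triv_module k H), X.
  exact: ideal_tensor pQ _ _ QX.
apply: (SQ (X ⊗ Res (triv_module k G))); first by exists X, (triv_module k G).
exact: ideal_tensorr pQ QX.
Qed.

Definition spc_res (Q : Spc (stable_category k H)) : Spc (stable_category k G) :=
  PrimeIdeal (proj2 (prime_modulesP _) (res_prime (prime_modules_of Q))).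

(** Take for T the complement of Q: if the induced module of X lies in P', it
lies in the prime under Q, so Q contains its restriction, of which X is a
summand. *)
Lemma spc_res_up (Q : Spc (stable_category k H)) (P' : Spc (stable_category k G)) :
  closure [set spc_res Q] P' ->
  exists2 Q', closure [set Q] Q' & spc_res Q' = P'.
Proof.
move=> /closure_point QP'; have pQ := prime_modules_of Q.
have pP' := prime_modules_of P'; have tQ := ideal_thick pQ.
have [||||Q' [pQ' Q'P' Q'Q]] := @prime_lift (prime_set P') [set X | ~ prime_set Q X].
- exact: pP'.
- exact: prime_unit.
- by move=> X Y nX nY /(prime_split pQ)[].
- move=> X nQX P'X; apply: nQX.
  apply: (thick_summand tQ (res_ind_retract sHG X)).
  apply: (QP' (Ind X)); have := P'X (triv_module k H).
  have iso : module_iso (X ⊗ triv_module k H) X.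
    exact: module_iso_trans (tens_comm _ _) (tens_unit X).
  by move/(thick_ind_iso sHG (ideal_thick pP') iso).
exists (PrimeIdeal (proj2 (prime_modulesP _) pQ')).
  by apply/closure_point => A Q'A; apply: contrapT => /Q'Q; apply.
exact: spc_eq.
Qed.

(** For Q to avoid A it suffices to avoid a multiplicative set around A.  The set
T of the objects that force A into every ideal containing them is such a set: it
is closed under products because ideals are radical, and it avoids [ind_ideal P]
because A does. *)
Lemma supp_ind A (P : Spc (stable_category k G)) : ~ prime_set P (Ind A) ->
  exists2 Q : Spc (stable_category k H), ~ prime_set Q A & spc_res Q = P.
Proof.
move=> nPA; have pP := prime_modules_of P.
have iI := ind_ideal_tensor (P := prime_set P) pP.
pose T := [set X | forall J, tensor_ideal J -> J X -> J A].
have [||||Q [pQ QP TQ]] := @prime_lift (prime_set P) T.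
- exact: pP.
- by move=> J iJ; apply: ideal_unit.
- move=> X Y TX TY J iJ JXY; apply: (ideal_radical iJ).
  apply: (TY _ (colon_ideal A iJ)) => /=.
  apply/(thick_iso (ideal_thick iJ) (tens_comm _ _)).
  exact: (TX _ (colon_ideal Y iJ)).
- move=> X TX IX; apply: nPA; have := TX _ iI IX (triv_module k H).
  have iso : module_iso (A ⊗ triv_module k H) A.
    exact: module_iso_trans (tens_comm _ _) (tens_unit A).
  by move/(thick_ind_iso sHG (ideal_thick pP) iso).
exists (PrimeIdeal (proj2 (prime_modulesP _) pQ)); last exact: spc_eq.
by apply: TQ => J.
Qed.

Lemma supp_ind_res A (Q : Spc (stable_category k H)) :
  ~ prime_set Q A -> ~ prime_set (spc_res Q) (Ind A).
Proof.
move=> nQA QA; apply: nQA.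
exact: (thick_summand (ideal_thick (prime_modules_of Q)) (res_ind_retract sHG A)).
Qed.

(** Every P in the support of the induced module lies under some Q in the
support of A, and a chain below P lifts to a chain below Q. *)
Lemma stable_ind_dim_le : relative_dim_le (stable_ind k sHG) 0.
Proof.
move=> l A /dim_leP Al; rewrite addr0; apply/dim_leP => P n /supp_ind[Q nQA <-].
move/(going_up_chain (@spc_sober k gT G) (@spc_t0 k gT H) spc_res_up).
exact: Al.
Qed.

End Lifting.

(** * Power sums and commutators of matrices *)

Section PowerSums.
Variables (p : nat).
Hypothesis pr_p : prime p.

(** If some nonzero u has u^j <> 1, multiplication by u permutes the summands
while it multiplies the sum by u^j; and otherwise 'X^j - 1 would have p - 1 > j
roots. *)
Lemma Fp_sum_expr j : (0 < j < p.-1)%N -> \sum_(x : 'F_p) x ^+ j = 0.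
Proof.
case/andP=> j_gt0 lt_jp.
have [/existsP[u /andP[u0 uj]]|] :=
    boolP [exists u : 'F_p, (u != 0) && (u ^+ j != 1)].
  apply: (mulfI (x := u ^+ j - 1)); first by rewrite subr_eq0.
  rewrite mulr0 mulrBl mul1r mulr_sumr [X in _ - X](reindex_inj (mulfI u0)) /=.
  apply/eqP; rewrite subr_eq0; apply/eqP.
  by apply: eq_bigr => x _; rewrite exprMn.
rewrite negb_exists => /forallP all1.
pose rs := enum (predC1 (0 : 'F_p)).
have szX : size ('X^j - 1%:P : {poly 'F_p}) = j.+1 by apply: size_XnsubC.
have X0 : 'X^j - 1%:P != 0 :> {poly 'F_p} by rewrite -size_poly_eq0 szX.
have := max_poly_roots X0 (rs := rs).
rewrite enum_uniq -cardE cardC1 (card_Fp pr_p) szX ltnS leqNgt lt_jp.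
have -> : all (root ('X^j - 1%:P)) rs.
  apply/allP=> x; rewrite mem_enum inE => x0; have := all1 x.
  by rewrite x0 negbK /root !hornerE subr_eq0.
by move=> /(_ isT isT).
Qed.

Lemma Fp_sum_expr_pred : \sum_(x : 'F_p) x ^+ p.-1 = -1.
Proof.
have p1 := prime_gt1 pr_p; have p0 := prime_gt0 pr_p.
have pp : (p.-1 != 0)%N by rewrite -lt0n -ltnS prednK.
rewrite (bigD1 0) //= expr0n (negPf pp) add0r.
rewrite (eq_bigr (fun _ => 1)) => [|x x0].
  have := cardC1 (0 : 'F_p); rewrite (card_Fp pr_p) sumr_const => ->.
  by apply/eqP; rewrite -addr_eq0 -mulrSr prednK // (pchar_Fp_0 pr_p).
apply: (mulfI x0); rewrite mulr1 -exprS prednK //.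
by rewrite -[RHS]expf_card (card_Fp pr_p).
Qed.

Lemma sum_natX_pchar (k : fieldType) j : p \in [pchar k] -> (j < p)%N ->
  (\sum_(0 <= i < p) i ^ j)%N%:R = (if j == p.-1 then -1 else 0 : k).
Proof.
move=> charp lt_jp; have p0 := prime_gt0 pr_p.
have FpE : (\sum_(0 <= i < p) i ^ j)%N%:R = \sum_(x : 'F_p) x ^+ j.
  rewrite -[X in \sum_(0 <= i < X) _](Fp_cast pr_p) big_mkord natr_sum.
  by apply: eq_bigr => x _; rewrite natrX natr_Zp.
have dvd (n : nat) : n%:R = 0 :> 'F_p -> n%:R = 0 :> k.
  by move/eqP; rewrite -(dvdn_pcharf (pchar_Fp pr_p)) (dvdn_pcharf charp) => /eqP.
case: eqP => [jE|/eqP jN].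
  apply/eqP; rewrite -addr_eq0 natr1; apply/eqP/dvd.
  by rewrite -natr1 FpE jE Fp_sum_expr_pred addNr.
have [j0|j_gt0] := posnP j.
  rewrite j0 (eq_bigr (fun _ => 1%N)) => [|i _]; last exact: expn0.
  by rewrite sum_nat_const_nat muln1 subn0 (pcharf0 charp).
apply: dvd; rewrite FpE Fp_sum_expr // j_gt0 /= ltn_neqAle jN /=.
by rewrite -ltnS prednK.
Qed.

End PowerSums.

Section CyclicPrime.
Variables (k : fieldType) (gT : finGroupType) (c : gT) (p : nat).
Hypotheses (charp : p \in [pchar k]) (oc : #[c]%g = p).
Local Notation C := <[c]>%g.
Implicit Types M : representation k [group of C].

Lemma cycle_sum (V : nmodType) (F : gT -> V) :
  \sum_(x in C) F x = \sum_(i < p) F (c ^+ i)%g.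
Proof.
have -> : C = [set (c ^+ (i : 'I_p))%g | i : 'I_p].
  apply/setP=> x; apply/idP/imsetP=> [/cyclePmin[i]|[i _ ->]].
    by rewrite oc => lt_ip ->; exists (Ordinal lt_ip).
  exact: mem_cycle.
rewrite big_imset //= => i j _ _ /eqP.
by rewrite eq_expg_mod_order oc !modn_small // => /eqP/val_inj.
Qed.

(** For the trace form, the image of X |-> X A - A X is the orthogonal of the
centralizer of A. *)
Lemma commutator_image n (A B : 'M[k]_n) :
    (forall D, A *m D = D *m A -> \tr (B *m D) = 0) ->
  exists X, X *m A - A *m X = B.
Proof.
move=> trB; pose L := lin_mulmxr A - lin_mulmx A.
have LE X : mxvec X *m L = mxvec (X *m A - A *m X).
  by rewrite mulmxBr !mul_vec_lin linearB.
suff /submxP[v vL] : (mxvec B <= L)%MS.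
  exists (vec_mx v); apply: (can_inj mxvecK).
  by rewrite -LE vec_mxK vL.
rewrite submxE; apply/eqP/matrixP=> i j; rewrite !ord1 [RHS]mxE.
pose w := col j (cokermx L); pose D := (vec_mx w^T)^T.
have wE Y : (mxvec Y *m w) 0 0 = \tr (Y *m D).
  rewrite mxE /mxtrace (reindex _ (curry_mxvec_bij _ _)) /=.
  transitivity (\sum_l \sum_m Y l m * D m l); last first.
    by apply: eq_bigr => l _; rewrite mxE.
  rewrite pair_bigA /=; apply: eq_bigr => -[l m] _ /=.
  by rewrite mxvecE !mxE.
have -> : (mxvec B *m cokermx L) 0 j = (mxvec B *m w) 0 0.
  by rewrite !mxE; apply: eq_bigr => l _; rewrite [w _ _]mxE.
rewrite wE; apply: trB; apply/eqP; rewrite -subr_eq0; apply/eqP.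
have Lw : L *m w = 0 by rewrite /w colE mulmxA mulmx_coker mul0mx.
have trX X : \tr (X *m (A *m D - D *m A)) = 0.
  have : \tr ((X *m A - A *m X) *m D) = 0.
    by rewrite -wE -LE -mulmxA Lw mulmx0 mxE.
  rewrite mulmxBl mulmxBr !linearB /= -!mulmxA => <-; congr (_ - _).
  by rewrite mxtrace_mulC -mulmxA mxtrace_mulC -mulmxA.
move: (_ - _) trX => E trE; apply/matrixP=> l m; rewrite [RHS]mxE.
rewrite -(trE (delta_mx m l)) -(mul_delta_mx (0 : 'I_1)) -mulmxA mxtrace_mulC.
by rewrite -rowE -colE /mxtrace big_ord1 !mxE.
Qed.

End CyclicPrime.

(** * The cyclic group of order p *)

Section CyclicSpectrum.
Variables (k : fieldType) (gT : finGroupType) (c : gT) (p : nat).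
Hypotheses (charp : p \in [pchar k]) (oc : #[c]%g = p).
Local Notation C := (<[c]>%G).
Implicit Types M : representation k C.

Let pr_p : prime p := pcharf_prime charp.

(** Expand each power: the coefficient of X^(p-1-j) is a multiple of the power
sum of exponent j over the prime field, which vanishes unless j = p - 1. *)
Lemma sum_expr_translates n (X : 'M[k]_n) :
  \sum_(i < p) (X + i%:R) ^+ p.-1 = -1.
Proof.
have p0 := prime_gt0 pr_p.
transitivity (\sum_(i < p) \sum_(j < p.-1.+1)
    (X ^+ (p.-1 - j) * i%:R ^+ j) *+ 'C(p.-1, j)).
  by apply: eq_bigr => i _; apply: exprDn_comm; apply: commr_nat.
rewrite exchange_big /= prednK //.
transitivity (\sum_(j < p) (X ^+ (p.-1 - j)
    * ((\sum_(0 <= i < p) i ^ j)%N%:R : k)%:M) *+ 'C(p.-1, j)).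
  apply: eq_bigr => j _; rewrite sumrMnl -mulr_sumr big_mkord.
  congr (_ * _ *+ _); rewrite raddfMn /= natr_sum.
  by apply: eq_bigr => i _; rewrite natrX.
have ltp : (p.-1 < p)%N by rewrite prednK.
rewrite (bigD1 (Ordinal ltp)) //= sum_natX_pchar // eqxx subnn expr0 binn.
rewrite mul1r mulr1n raddfN big1 ?addr0 // => j /eqP jN.
rewrite sum_natX_pchar //; case: eqP => [jE|_].
  by case: jN; apply: val_inj.
by rewrite raddf0 mulr0 mul0rn.
Qed.

(** Let a be the action of the generator.  If f commutes with a, so does a f, so
a is orthogonal to the centralizer of a; hence a = X a - a X for some X.  This
says that conjugation by a sends X to X + 1, so that the conjugates of X^(p-1)
are the (X + i)^(p-1), and these add up to -1. *)
Lemma trace_zero_traceable M :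
  (forall f, equivariant M M f -> \tr f = 0) -> traceable M.
Proof.
move=> tr0; have Cc : c \in C := cycle_id c.
pose a := M c.
have [X XE] : exists X, X *m a - a *m X = a.
  apply: commutator_image => D aD; apply: tr0 => _ /cycleP[i ->].
  elim: i => [|i IHi]; first by rewrite expg0 repr_mx1 mul1mx mulmx1.
  rewrite expgS repr_mxM ?mem_cycle // -mulmxA IHi !mulmxA; congr (_ *m _).
  by rewrite -!mulmxA aD.
have X1 : M c^-1%g *m X *m a = X + 1.
  have -> : M c^-1%g *m X *m a = M c^-1%g *m (a *m (X + 1%:M)).
    by rewrite -mulmxA mulmxDr mulmx1; congr (_ *m _); rewrite -{3}XE addrC subrK.
  by rewrite repr_mulVK.
have conjX i : M (c ^- i)%g *m X *m M (c ^+ i)%g = X + i%:R.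
  elim: i => [|i IHi].
    by rewrite invg1 repr_mx1 mul1mx mulmx1 addr0.
  have Ci : (c ^+ i)%g \in C by apply: mem_cycle.
  rewrite expgSr invMg !repr_mxM ?groupV // -!mulmxA (mulmxA X).
  rewrite (mulmxA (M (c ^- i)%g)) (mulmxA (M (c ^- i)%g)) IHi.
  rewrite mulmxDl mulmxDr mulmxA X1 -addrA; congr (_ + _).
  have -> : (i%:R : 'M[k]_(rdegree M)) *m M c = M c *m i%:R.
    exact/esym/commr_nat.
  by rewrite repr_mulVK // nat1r.
have conjXn i m : M (c ^- i)%g *m X ^+ m *m M (c ^+ i)%g = (X + i%:R) ^+ m.
  have Ci : (c ^+ i)%g \in C by apply: mem_cycle.
  elim: m => [|m IHm].
    by rewrite expr0 mulmx1 -repr_mxM ?groupV // mulVg repr_mx1.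
  rewrite !exprS -IHm -conjX -!mulmxE -!mulmxA (mulmxA (M (c ^+ i)%g)).
  by rewrite -repr_mxM ?groupV // mulgV repr_mx1 mul1mx.
exists (- X ^+ p.-1); rewrite transferN /transfer (cycle_sum oc).
rewrite (eq_bigr (fun i : 'I_p => (X + i%:R) ^+ p.-1)) => [|i _].
  by rewrite sum_expr_translates opprK.
exact: conjXn.
Qed.

Lemma unit_not_traceable : ~ traceable (triv_module k C).
Proof.
case=> s; rewrite /transfer (eq_bigr (fun=> s)) => [|x Cx]; last first.
  by rewrite mul1mx mulmx1.
rewrite sumr_const -orderE oc => /matrixP/(_ 0 0)/eqP.
by rewrite mulmxnE -mulr_natr (pcharf0 charp) mulr0 mxE eqxx eq_sym oner_eq0.
Qed.

(** If M is not projective, it has an equivariant endomorphism of nonzero trace;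
then the unit is a summand of [M ⊗ dual M], and Q is not proper. *)
Lemma cyclic_prime (Q : set (representation k C)) M :
  prime_modules Q -> Q M -> traceable M.
Proof.
move=> pQ QM; apply: trace_zero_traceable => f ef.
apply: contrapT => /eqP tr0; apply: (prime_unit pQ).
apply: (thick_summand (ideal_thick pQ) (trace_retract ef tr0)).
exact: ideal_tensorr pQ QM.
Qed.

Lemma cyclic_spc_eq (P Q : Spc (stable_category k C)) : P = Q.
Proof.
have PE (R : Spc (stable_category k C)) A : prime_set R A <-> traceable A.
  split; first exact/cyclic_prime/prime_modules_of.
  exact: (thick_traceable (ideal_thick (prime_modules_of R))).
by apply: spc_eq => A; split=> /PE tA; apply/PE.
Qed.

Lemma cyclic_spc_exists : exists P : Spc (stable_category k C), True.
Proof.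
have [|||Q [pQ _ _]] := @prime_exists _ _ _ _ [set triv_module k C] (traceable_ideal k C).
- by exists (triv_module k C).
- by move=> _ ->; apply: unit_not_traceable.
- move=> _ _ -> ->; exists (triv_module k C) => //.
  exact/module_iso_sym/tens_unit.
by exists (PrimeIdeal (proj2 (prime_modulesP _) pQ)).
Qed.

Lemma cyclic_dim_le (A : stable_category k C) : dim_le 0 A.
Proof.
apply/dim_leP => P [|n] _ //= [D [irrD ltD _]].
have [_ D10] := ltD 0%N isT; case: D10 => Q _.
by have [_ [R DR] _] := irrD 0%N isT; rewrite (cyclic_spc_eq Q R).
Qed.

End CyclicSpectrum.

Theorem theorem6p5p11 (k : fieldType) (gT : finGroupType) (G H : {group gT})
    (p : nat) (charp : p \in [pchar k]) (pG : (p %| #|G|)%N)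
    (sHG : H \subset G) (pH : (p %| #|H|)%N) :
  has_relative_dimension (stable_ind k sHG) 0.
Proof.
split=> [||m Fm]; [exact: stable_ind_exact|exact: stable_ind_dim_le|].
have [c Hc oc] := Cauchy (pcharf_prime charp) pH.
have sCH : <[c]>%G \subset H by rewrite cycle_subG.
have [P _] := cyclic_spc_exists charp oc.
have A0 : dim_le 0 (stable_ind k sCH (triv_module k <[c]>%G)).
  have := stable_ind_dim_le sCH (cyclic_dim_le charp oc (triv_module k _)).
  by rewrite addr0.
have PA := supp_ind_res (sHG := sCH) (prime_unit (prime_modules_of P)).
have PB := supp_ind_res (sHG := sHG) PA.
have /dim_leP := Fm 0 _ A0; rewrite add0r => mB.
exact: mB _ 0%N PB (closed_chain0 _).
Qed.
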